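(* Let $F$ be a field of characteristic $2$ and let $\phi$ be an anisotropic quadratic form over $F$ of type $(1,3)$ which is a Pfister neighbor. Then, up to a scalar in $F^*$, $\phi$ is isometric to $rs[1,u]\perp\langle 1,r,s\rangle$ for suitable $r,s,u\in F^*$. Moreover, $C_0(\phi)$ is split as a $K$-algebra, where $K=F(\sqrt r,\sqrt s)$.
   Context: $[a,b]$ denotes the binary quadratic form $ax^2+xy+by^2$; $\langle c_1,\dots,c_s\rangle$ is the form $\sum c_iz_i^2$; $\perp$ is orthogonal sum and $\simeq$ isometry. A quadratic form is of type $(r,s)$ if it is isometric to $[a_1,b_1]\perp\cdots\perp[a_r,b_r]\perp\langle c_1,\dots,c_s\rangle$. $C_0(\phi)$ is the even Clifford algebra of $\phi$. $(V,\phi)$ is dominated by $(W,\psi)$, written $\phi\prec\psi$, if there is an injective $F$-linear map $\sigma:V\to W$ with $\phi(v)=\psi(\sigma(v))$ for all $v\in V$. For $a_i\in F^*$, $c\in F$, the $m$-fold quadratic Pfister form $\langle\langle a_1,\dots,a_{m-1},c]]$ is $\langle\langle a_1,\dots,a_{m-1}\rangle\rangle_b\cdot[1,c]$, where $\langle\langle a_1,\dots,a_n\rangle\rangle_b=\langle1,a_1\rangle_b\otimes\cdots\otimes\langle1,a_n\rangle_b$, $\langle d_1,\dots,d_k\rangle_b$ is the diagonal bilinear form and $\langle d_1,\dots,d_k\rangle_b\cdot q=d_1q\perp\cdots\perp d_kq$. A quadratic form $\phi$ is a Pfister neighbor if there are a quadratic Pfister form $\pi$ and $\alpha\in F^*$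 with $\alpha\phi\prec\pi$ and $2\dim\phi>\dim\pi$. A $K$-algebra is split if it is isomorphic to a full matrix algebra over $K$. *)

(* Defs.v *)
From HB Require Import structures.
From mathcomp Require Import all_boot all_order all_algebra all_field.
From mathcomp Require Import boolp ring.

Set Implicit Arguments.
Unset Strict Implicit.
Unset Printing Implicit Defensive.

Import GRing.Theory.
Local Open Scope ring_scope.
Local Open Scope quotient_scope.

Definition polar (F : fieldType) (V : lmodType F) (q : V -> F) (u v : V) : F :=
  q (u + v) - q u - q v.

(* polar q is symmetric, so linearity on the left is bilinearity *)
Definition is_quadratic (F : fieldType) (V : lmodType F) (q : V -> F) : Prop :=
  (forall a v, q (a *: v) = a ^+ 2 * q v) /\
  (forall a u v w, polar q (a *: u + v) w = a * polar q u w + polar q v w).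

Record quadForm (F : fieldType) := QuadForm {
  qf_space :> vectType F;
  qval : qf_space -> F;
  qvalP : is_quadratic qval
}.

Arguments qval {F} phi v : rename.
Arguments qvalP {F} phi : rename.

Section Operations.
Variable F : fieldType.
Implicit Types (phi psi : quadForm F) (a b c : F).

Definition qdim phi : nat := \dim {: phi}.

Definition isometric phi psi : Prop :=
  exists sigma : {linear phi -> psi},
    bijective sigma /\ forall v, qval phi v = qval psi (sigma v).

Definition dominated phi psi : Prop :=
  exists sigma : {linear phi -> psi},
    injective sigma /\ forall v, qval phi v = qval psi (sigma v).

Definition anisotropic phi : Prop := forall v : phi, qval phi v = 0 -> v = 0.

Lemma qbin_subproof a b :
  is_quadratic (fun v : (F^o * F^o)%type =>
    a * v.1 ^+ 2 + (v.1 : F) * v.2 + b * v.2 ^+ 2).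
Proof.
split=> [c [x y]|c [x1 y1] [x2 y2] [x3 y3]]; rewrite /polar /= /GRing.scale /=;
  ring.
Qed.

Definition qbin a b : quadForm F := QuadForm (qbin_subproof a b).

Lemma qdiag_subproof (c : seq F) :
  is_quadratic (fun z : 'rV[F]_(size c) => \sum_(i < size c) c`_i * z 0 i ^+ 2).
Proof.
split=> [a z|a u v w].
  by rewrite mulr_sumr; apply: eq_bigr => i _; rewrite mxE; ring.
rewrite /polar !mulrBr !mulr_sumr -!sumrB -big_split /=.
by apply: eq_bigr => i _; rewrite !mxE; ring.
Qed.

Definition qdiag (c : seq F) : quadForm F := QuadForm (qdiag_subproof c).

Lemma qperp_subproof phi psi :
  is_quadratic (fun v : (phi * psi)%type => qval phi v.1 + qval psi v.2).
Proof.
have [qZ qD] := qvalP phi; have [pZ pD] := qvalP psi.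
split=> [c [u v]|c [u u'] [v v'] [w w']]; first by rewrite /= qZ pZ mulrDr.
move: (qD c u v w) (pD c u' v' w'); rewrite /polar /= => e1 e2.
have -> : forall a b a1 b1 a2 b2 : F,
  a + b - (a1 + b1) - (a2 + b2) = (a - a1 - a2) + (b - b1 - b2).
  by move=> *; ring.
by rewrite e1 e2; ring.
Qed.

Definition qperp phi psi : quadForm F := QuadForm (qperp_subproof phi psi).

Lemma qscale_subproof a phi : is_quadratic (fun v : phi => a * qval phi v).
Proof.
have [qZ qD] := qvalP phi; split=> [c v|c u v w]; first by rewrite qZ mulrCA.
by move: (qD c u v w); rewrite /polar -!mulrBr => ->; ring.
Qed.

Definition qscale a phi : quadForm F := QuadForm (qscale_subproof a phi).

(* qdiag [::] is the form on the zero space, neutral for qperp up to isometry *)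
Definition qperps (s : seq (quadForm F)) : quadForm F :=
  foldr qperp (qdiag [::]) s.

Definition of_type (r s : nat) phi : Prop :=
  exists (ab : r.-tuple (F * F)) (c : s.-tuple F),
    isometric phi (qperp (qperps [seq qbin p.1 p.2 | p <- ab]) (qdiag c)).

(* The diagonal bilinear form <d_1, ..., d_k>_b is represented by the sequence
   of its coefficients. *)
Definition diagb := seq F.

Definition tensorb (d e : diagb) : diagb := [seq x * y | x <- d, y <- e].

Definition pfisterb (a : seq F) : diagb :=
  foldr (fun x => tensorb [:: 1; x]) [:: 1] a.

Definition bmul (d : diagb) phi : quadForm F :=
  qperps [seq qscale x phi | x <- d].

Definition pfister (a : seq F) c : quadForm F := bmul (pfisterb a) (qbin 1 c).

Definition is_pfister pi : Prop :=
  exists (a : seq F) c, all (fun x => x != 0) a /\ isometric pi (pfister a c).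

Definition pfister_neighbor phi : Prop :=
  exists (pi : quadForm F) (alpha : F),
    [/\ is_pfister pi, alpha != 0, dominated (qscale alpha phi) pi
      & (qdim pi < 2 * qdim phi)%N].

End Operations.

(* The Clifford algebra C(phi) is the F-algebra presented by a linear map
   phi -> C(phi) and the relations v * v = phi v, i.e., the quotient of the
   tensor algebra of the underlying space by the ideal generated by the
   elements v (x) v - phi v. *)
Section Clifford.
Variables (F : fieldType) (phi : quadForm F).

Inductive clif_term :=
| CConst of F
| CVec of phi
| CAdd of clif_term & clif_term
| CMul of clif_term & clif_term.

Inductive clif_eq : clif_term -> clif_term -> Prop :=
| clif_refl x : clif_eq x x
| clif_sym x y : clif_eq x y -> clif_eq y x
| clif_trans y x z : clif_eq x y -> clif_eq y z -> clif_eq x z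
| clif_congD x x' y y' :
    clif_eq x x' -> clif_eq y y' -> clif_eq (CAdd x y) (CAdd x' y')
| clif_congM x x' y y' :
    clif_eq x x' -> clif_eq y y' -> clif_eq (CMul x y) (CMul x' y')
| clif_addA x y z : clif_eq (CAdd x (CAdd y z)) (CAdd (CAdd x y) z)
| clif_addC x y : clif_eq (CAdd x y) (CAdd y x)
| clif_add0 x : clif_eq (CAdd (CConst 0) x) x
| clif_mulA x y z : clif_eq (CMul x (CMul y z)) (CMul (CMul x y) z)
| clif_mul1 x : clif_eq (CMul (CConst 1) x) x
| clif_mul0 x : clif_eq (CMul (CConst 0) x) (CConst 0)
| clif_mulDl x y z :
    clif_eq (CMul (CAdd x y) z) (CAdd (CMul x z) (CMul y z))
| clif_mulDr x y z :
    clif_eq (CMul x (CAdd y z)) (CAdd (CMul x y) (CMul x z))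
| clif_constD a b : clif_eq (CConst (a + b)) (CAdd (CConst a) (CConst b))
| clif_constM a b : clif_eq (CConst (a * b)) (CMul (CConst a) (CConst b))
| clif_constC a x : clif_eq (CMul (CConst a) x) (CMul x (CConst a))
| clif_vecD u v : clif_eq (CVec (u + v)) (CAdd (CVec u) (CVec v))
| clif_vecZ a v : clif_eq (CVec (a *: v)) (CMul (CConst a) (CVec v))
| clif_vec_sq v : clif_eq (CMul (CVec v) (CVec v)) (CConst (qval phi v)).

HB.instance Definition _ := gen_eqMixin clif_term.
HB.instance Definition _ := gen_choiceMixin clif_term.

Definition clif_eqb (x y : clif_term) : bool := `[< clif_eq x y >].

Lemma clif_eqb_refl : reflexive clif_eqb.
Proof. by move=> x; apply/asboolP; constructor. Qed.
Lemma clif_eqb_sym : symmetric clif_eqb.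
Proof. by move=> x y; apply/asboolP/asboolP; apply: clif_sym. Qed.
Lemma clif_eqb_trans : transitive clif_eqb.
Proof.
by move=> y x z /asboolP xy /asboolP yz; apply/asboolP/clif_trans/yz.
Qed.

Canonical clif_equiv :=
  EquivRel clif_eqb clif_eqb_refl clif_eqb_sym clif_eqb_trans.

Definition clifford := {eq_quot clif_equiv}.

HB.instance Definition _ := Choice.on clifford.
HB.instance Definition _ := Quotient.on clifford.

Implicit Types (x y z : clifford).

Definition cpi (t : clif_term) : clifford := \pi t.

Lemma cpiP s t : cpi s = cpi t <-> clif_eq s t.
Proof.
split=> [/eqmodP /asboolP //|st]; by apply/eqmodP/asboolP.
Qed.

Lemma cpiK x : cpi (repr x) = x. Proof. exact: reprK. Qed.

Lemma cpi_repr t : clif_eq (repr (cpi t)) t.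
Proof. by apply/cpiP; rewrite cpiK. Qed.

Definition cadd x y := cpi (CAdd (repr x) (repr y)).
Definition cmul x y := cpi (CMul (repr x) (repr y)).

Lemma cpiD s t : cpi (CAdd s t) = cadd (cpi s) (cpi t).
Proof. by apply/cpiP/clif_congD; apply/clif_sym/cpi_repr. Qed.
Lemma cpiM s t : cpi (CMul s t) = cmul (cpi s) (cpi t).
Proof. by apply/cpiP/clif_congM; apply/clif_sym/cpi_repr. Qed.

Lemma caddA : associative cadd.
Proof.
move=> x y z; rewrite -[x]cpiK -[y]cpiK -[z]cpiK -!cpiD.
exact/cpiP/clif_addA.
Qed.
Lemma caddC : commutative cadd.
Proof.
by move=> x y; rewrite -[x]cpiK -[y]cpiK -!cpiD; apply/cpiP/clif_addC.
Qed.
Lemma cadd0 : left_id (cpi (CConst 0)) cadd.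
Proof. by move=> x; rewrite -[x]cpiK -!cpiD; apply/cpiP/clif_add0. Qed.
Lemma cmulA : associative cmul.
Proof.
move=> x y z; rewrite -[x]cpiK -[y]cpiK -[z]cpiK -!cpiM.
exact/cpiP/clif_mulA.
Qed.
Lemma cmul1 : left_id (cpi (CConst 1)) cmul.
Proof. by move=> x; rewrite -[x]cpiK -!cpiM; apply/cpiP/clif_mul1. Qed.
Lemma cmulC_const a x : cmul (cpi (CConst a)) x = cmul x (cpi (CConst a)).
Proof. by rewrite -[x]cpiK -!cpiM; apply/cpiP/clif_constC. Qed.
Lemma cmul1r : right_id (cpi (CConst 1)) cmul.
Proof. by move=> x; rewrite -cmulC_const cmul1. Qed.
Lemma cmulDl : left_distributive cmul cadd.
Proof.
move=> x y z; rewrite -[x]cpiK -[y]cpiK -[z]cpiK -!(cpiD, cpiM).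
exact/cpiP/clif_mulDl.
Qed.
Lemma cmulDr : right_distributive cmul cadd.
Proof.
move=> x y z; rewrite -[x]cpiK -[y]cpiK -[z]cpiK -!(cpiD, cpiM).
exact/cpiP/clif_mulDr.
Qed.

Definition copp x := cmul (cpi (CConst (-1))) x.

Lemma caddN : left_inverse (cpi (CConst 0)) copp cadd.
Proof.
move=> x; rewrite /copp -{2}[x]cmul1 -cmulDl -cpiD.
have /cpiP <- := clif_constD (-1) 1.
by rewrite addNr -[x]cpiK -cpiM; apply/cpiP/clif_mul0.
Qed.

HB.instance Definition _ :=
  GRing.isZmodule.Build clifford caddA caddC cadd0 caddN.
HB.instance Definition _ :=
  GRing.Zmodule_isPzRing.Build clifford cmulA cmul1 cmul1r cmulDl cmulDr.

Definition cscale (a : F) x : clifford := cpi (CConst a) * x.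

Lemma cscaleA a b x : cscale a (cscale b x) = cscale (a * b) x.
Proof.
rewrite /cscale mulrA; congr (_ * _); rewrite -[LHS]cpiM.
by apply/esym/cpiP/clif_constM.
Qed.
Lemma cscale1 : left_id 1 cscale.
Proof. exact: cmul1. Qed.
Lemma cscaleDr : right_distributive cscale +%R.
Proof. by move=> a x y; apply: mulrDr. Qed.
Lemma cscaleDl x : {morph cscale^~ x : a b / a + b}.
Proof.
move=> a b; rewrite /cscale -mulrDl; congr (_ * _); rewrite -[RHS]cpiD.
by apply/cpiP/clif_constD.
Qed.

HB.instance Definition _ :=
  GRing.Zmodule_isLmodule.Build F clifford cscaleA cscale1 cscaleDr cscaleDl.

Section Eval.
Variables (A : algType F) (j : {linear phi -> A}).
Hypothesis j_sq : forall v, j v * j v = (qval phi v)%:A.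

Fixpoint ceval (t : clif_term) : A :=
  match t with
  | CConst a => a%:A
  | CVec v => j v
  | CAdd s t => ceval s + ceval t
  | CMul s t => ceval s * ceval t
  end.

Lemma ceval_eq s t : clif_eq s t -> ceval s = ceval t.
Proof.
elim=> //=.
- by move=> y x z _ -> _ ->.
- by move=> x x' y y' _ -> _ ->.
- by move=> x x' y y' _ -> _ ->.
- by move=> *; rewrite addrA.
- by move=> *; rewrite addrC.
- by move=> *; rewrite scale0r add0r.
- by move=> *; rewrite mulrA.
- by move=> *; rewrite scale1r mul1r.
- by move=> *; rewrite scale0r mul0r.
- by move=> *; rewrite mulrDl.
- by move=> *; rewrite mulrDr.
- by move=> *; rewrite scalerDl.
- by move=> *; rewrite mulr_algl scalerA.
- by move=> *; rewrite mulr_algl mulr_algr.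
- by move=> *; rewrite linearD.
- by move=> *; rewrite linearZ /= mulr_algl.
Qed.
End Eval.

(* C(phi) <> 0: the matrix M = cmat n v f depends linearly on (v, f) and
   satisfies M ^+ 2 = \sum_(i < n) v i * f i. *)
Fixpoint cdim (n : nat) : nat :=
  if n is n'.+1 then (cdim n' + (cdim n').+1)%N else 0%N.

Fixpoint cmat (n : nat) (v f : nat -> F) : 'M[F]_((cdim n).+1) :=
  match n with
  | 0 => 0
  | n'.+1 => block_mx (cmat n' v f) (f n')%:M (v n')%:M (- cmat n' v f)
  end.

Lemma cmat_sq n v f :
  cmat n v f *m cmat n v f = (\sum_(i < n) v i * f i)%:M.
Proof.
elim: n => [|n IHn]; first by rewrite big_ord0 mul0mx raddf0.
pose B := block_mx (cmat n v f) (f n)%:M (v n)%:M (- cmat n v f).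
suff: B *m B = (\sum_(i < n.+1) v i * f i)%:M by exact: id.
rewrite /B mulmx_block big_ord_recr /=.
rewrite !mulNmx !mulmxN opprK IHn !(scalar_mxC _ (cmat n v f)) !subrr.
rewrite -!scalar_mxM -!raddfD /= (mulrC (f n)) (addrC (v n * f n)).
by rewrite -scalar_mx_block.
Qed.

Lemma cmat_linear n a v f v' f' v'' f'' :
    (forall k, v'' k = a * v k + v' k) -> (forall k, f'' k = a * f k + f' k) ->
  cmat n v'' f'' = a *: cmat n v f + cmat n v' f'.
Proof.
move=> Ev Ef; elim: n => [|n IHn]; first by rewrite /= scaler0 addr0.
pose B w g := block_mx (cmat n w g) (g n)%:M (w n)%:M (- cmat n w g).
suff: B v'' f'' = a *: B v f + B v' f' by exact: id.
rewrite /B scale_block_mx add_block_mx IHn Ev Ef !raddfD /= !scale_scalar_mx.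
by rewrite scalerN.
Qed.

Lemma polar_suml n (c : nat -> F) (e : nat -> phi) w :
  polar (qval phi) (\sum_(j < n) c j *: e j) w
  = \sum_(j < n) c j * polar (qval phi) (e j) w.
Proof.
have [qZ qD] := qvalP phi.
elim: n => [|n IHn].
  have q0 : qval phi 0 = 0 by rewrite -(scale0r 0) qZ expr0n mul0r.
  by rewrite !big_ord0 /polar add0r q0 subr0 subrr.
by rewrite !big_ord_recr /= addrC qD IHn addrC.
Qed.

Lemma qval_sum n (c : nat -> F) (e : nat -> phi) :
  qval phi (\sum_(i < n) c i *: e i) =
  \sum_(i < n) c i * (c i * qval phi (e i)
                      + \sum_(j < i) c j * polar (qval phi) (e j) (e i)).
Proof.
have [qZ qD] := qvalP phi.
elim: n => [|n IHn].
  by rewrite !big_ord0 -(scale0r 0) qZ expr0n mul0r.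
rewrite !big_ord_recr /= -IHn.
have polarZr a u w : polar (qval phi) u (a *: w) = a * polar (qval phi) u w.
  have pC (x y : phi) : polar (qval phi) x y = polar (qval phi) y x.
    by rewrite /polar (addrC y) addrAC.
  rewrite pC (pC u) -[a *: w]addr0 qD.
  suff -> : polar (qval phi) 0 u = 0 by rewrite addr0.
  have q0 : qval phi 0 = 0 by rewrite -(scale0r 0) qZ expr0n mul0r.
  by rewrite /polar add0r q0 subr0 subrr.
have /(_ (\sum_(i < n) c i *: e i) (c n *: e n)) :
    forall u w, qval phi (u + w) = qval phi u + (qval phi w
                                     + polar (qval phi) u w).
  by move=> u w; rewrite /polar; ring.
move=> ->; rewrite polarZr polar_suml qZ; ring.
Qed.

Let n := \dim {: phi}.
Let e (k : nat) : phi := (vbasis {: phi})`_k.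
Let cv (x : phi) (k : nat) : F :=
  if insub k is Some i then coord (vbasis {: phi}) i x else 0.
Let cf (x : phi) (k : nat) : F :=
  cv x k * qval phi (e k) + \sum_(j < k) cv x j * polar (qval phi) (e j) (e k).

Let cv_linear a (x y : phi) k : cv (a *: x + y) k = a * cv x k + cv y k.
Proof.
by rewrite /cv; case: insubP => [i _ _|_]; rewrite ?linearP ?mulr0 ?addr0.
Qed.

Let cf_linear a (x y : phi) k : cf (a *: x + y) k = a * cf x k + cf y k.
Proof.
rewrite /cf cv_linear; under eq_bigr do rewrite cv_linear mulrDl -mulrA.
by rewrite big_split /= -mulr_sumr; ring.
Qed.

Let crep (x : phi) := cmat n (cv x) (cf x).

Let crep_linear : linear crep.
Proof.
by move=> a x y; apply: cmat_linear => k; rewrite (cv_linear, cf_linear).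
Qed.

HB.instance Definition _ :=
  GRing.isLinear.Build F phi 'M[F]_((cdim n).+1) _ crep crep_linear.

Let crep_sq (x : phi) : crep x * crep x = (qval phi x)%:A.
Proof.
rewrite -[LHS]/(crep x *m crep x) cmat_sq -qval_sum.
rewrite -[RHS]/(qval phi x *: 1%:M) scalemx1; congr (qval phi _)%:M.
rewrite [RHS](coord_vbasis (memvf x)); apply: eq_bigr => i _.
by rewrite /cv valK.
Qed.

Lemma clifford_nontrivial : (1 : clifford) != 0.
Proof.
apply/eqP => /cpiP /(ceval_eq crep_sq) /= /eqP.
by rewrite scale1r scale0r oner_eq0.
Qed.

HB.instance Definition _ :=
  GRing.PzSemiRing_isNonZero.Build clifford clifford_nontrivial.

Lemma cscaleAl (a : F) x y : a *: (x * y) = (a *: x) * y.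
Proof. exact: mulrA. Qed.
Lemma cscaleAr (a : F) x y : a *: (x * y) = x * (a *: y).
Proof.
rewrite [LHS]mulrA [_ * x]cmulC_const; exact: esym (mulrA _ _ _).
Qed.

HB.instance Definition _ := GRing.Lmodule_isLalgebra.Build F clifford cscaleAl.
HB.instance Definition _ := GRing.Lalgebra_isAlgebra.Build F clifford cscaleAr.

Definition clif_vec (v : phi) : clifford := cpi (CVec v).

Lemma clif_vec_linear : linear clif_vec.
Proof.
move=> a u v; rewrite /clif_vec -[RHS]/(cadd (cmul _ _) _) -cpiM -cpiD.
apply/cpiP; apply: clif_trans (clif_vecD _ _) _.
by apply: clif_congD (clif_refl _); apply: clif_vecZ.
Qed.

HB.instance Definition _ :=
  GRing.isLinear.Build F phi clifford _ clif_vec clif_vec_linear.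

Lemma clif_vec_sqr v : clif_vec v * clif_vec v = (qval phi v)%:A.
Proof.
rewrite -[LHS]cpiM -[RHS]cpiM; apply/cpiP.
apply: clif_trans (clif_vec_sq v) _; apply: clif_sym.
apply: clif_trans (clif_constC _ _) _; exact: clif_mul1.
Qed.

Lemma clifford_universal (A : algType F) (j : {linear phi -> A}) :
    (forall v, j v * j v = (qval phi v)%:A) ->
  exists f : {lrmorphism clifford -> A},
    (forall v, f (clif_vec v) = j v) /\
    (forall g : {lrmorphism clifford -> A},
       (forall v, g (clif_vec v) = j v) -> g =1 f).
Proof.
move=> j_sq; pose h (x : clifford) : A := ceval j (repr x).
have hpi t : h (cpi t) = ceval j t by apply/ceval_eq/cpi_repr.
have h_lin : linear h.
  move=> a x y; rewrite -[x]cpiK -[y]cpiK -[_ *: _]cpiM -[_ + _]cpiD !hpi /=.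
  by rewrite mulr_algl.
have h_mul : monoid_morphism h.
  split=> [|x y]; first by rewrite [LHS]hpi /= scale1r.
  by rewrite -[x]cpiK -[y]cpiK -[_ * _]cpiM !hpi.
pose hL := GRing.isLinear.Build F clifford A _ h h_lin.
pose hM := GRing.isMonoidMorphism.Build clifford A h h_mul.
pose f : {lrmorphism clifford -> A} := HB.pack h hL hM.
exists f; split=> [v|g gv x]; first exact: hpi.
rewrite -[x]cpiK -[f _]/(h _) hpi.
elim: (repr x) => [a|v|s IHs t IHt|s IHs t IHt] /=.
- suff -> : cpi (CConst a) = a%:A by rewrite linearZ rmorph1.
  by rewrite -[LHS]cmul1r.
- exact: gv.
- by rewrite -IHs -IHt -rmorphD; congr (g _); apply: cpiD.
- by rewrite -IHs -IHt -rmorphM; congr (g _); apply: cpiM.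
Qed.

(* C_0(phi): the F-span of the products of an even number of vectors *)
Inductive in_even : clifford -> Prop :=
| even_prod (s : seq phi) :
    ~~ odd (size s) -> in_even (\prod_(v <- s) clif_vec v)
| even_add x y : in_even x -> in_even y -> in_even (x + y)
| even_scale (a : F) x : in_even x -> in_even (a *: x).

Definition even_pred : {pred clifford} := fun x => `[< in_even x >].

Lemma even_closed : GRing.subsemialg_closed even_pred.
Proof.
have E1 : in_even 1 by have := @even_prod [::] isT; rewrite big_nil.
split; first exact/asboolP.
- split=> [|x y /asboolP xE /asboolP yE]; apply/asboolP; last exact: even_add.
  by rewrite -(scale0r 1); apply: even_scale.
- by move=> a x /asboolP xE; apply/asboolP/even_scale.
move=> x y /asboolP xE /asboolP yE; apply/asboolP.
elim: xE => {x} [s sE|x1 x2 _ IH1 _ IH2|a x _ IH]; last 2 first.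
- by rewrite mulrDl; apply: even_add.
- by rewrite -scalerAl; apply: even_scale.
elim: yE => {y} [t tE|y1 y2 _ IH1 _ IH2|a y _ IH].
- rewrite -big_cat; apply: even_prod.
  by rewrite size_cat oddD addbC (negPf sE) addbF.
- by rewrite mulrDr; apply: even_add.
- by rewrite -scalerAr; apply: even_scale.
Qed.

HB.instance Definition _ :=
  GRing.isSubalgClosed.Build F clifford even_pred even_closed.

Record even_clifford := EvenClifford {
  even_val : clifford;
  even_valP : even_val \in even_pred
}.

HB.instance Definition _ := [isSub for even_val].
HB.instance Definition _ := [Choice of even_clifford by <:].
HB.instance Definition _ := [SubChoice_isSubAlgebra of even_clifford by <:].

End Clifford.

(* A K-algebra structure on A compatible with its F-algebra structure is an
   F-algebra morphism from K to the centre of A. *)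
Definition is_central (F : fieldType) (K : fieldExtType F) (A : algType F)
    (iota : {lrmorphism K -> A}) : Prop :=
  forall k a, iota k * a = a * iota k.

Definition is_split (F : fieldType) (K : fieldExtType F) (A : algType F)
    (iota : {lrmorphism K -> A}) : Prop :=
  exists (n : nat) (f : {rmorphism A -> 'M[K]_n.+1}),
    bijective f /\ forall k a, f (iota k * a) = k *: f a.

Definition is_sqrt_extension (F : fieldType) (r s : F) (K : fieldExtType F)
    : Prop :=
  exists x y : K,
    [/\ x ^+ 2 = r%:A, y ^+ 2 = s%:A & <<1 & [:: x; y]>>%VS = fullv].

(* Main.v *)
Require Import Defs.
From HB Require Import structures.
From mathcomp Require Import all_boot all_order all_algebra all_field.
From mathcomp Require Import boolp ring.

(** The dimension bounds force the ambient Pfister form to be 3-fold, so it is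
    the norm form of an octonion algebra: it carries a bilinear unital product
    for which the form is multiplicative ([oct_composition], obtained by
    Cayley-Dickson doubling).  Let [g0, g1, g2] be a basis of the radical of the
    polar form of [phi].  Dividing by the image of [g0] is a similarity of the
    octonions which sends [g0] to the unit and embeds [phi / phi(g0)]
    ([comp_translate]).  The images [x, y] of [g1, g2] are then orthogonal to
    each other and to the unit, with norms [r, s], and the product [x y] has
    norm [r s] and is orthogonal to [1, x, y] ([comp_product]).  Since [phi] has
    dimension 5 = 8 - 3, its image is the whole orthogonal complement of its
    radical, so [x y] is the image of some [f1] in [phi]
    ([orthogonal_complement]).  Anisotropy keeps [f1] out of the radical
    ([comp_product_notin]), so some [f2] is not orthogonal to it; once [f2] is
    rescaled, the plane spanned by [f1, f2] is a multiple of [rs[1, u]], which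
    gives the normal form ([neighbor_normal_form]).

    For the Clifford algebra, the radical vectors are central, and
    [v |-> phi(g0)^-1 g0 v] is a linear map from [phi] to generators of
    [C_0(phi)] ([even_gen]).  It sends [g0] to 1, it sends [g1, g2] to central
    elements [X, Y] with squares [r, s], and it sends [f1, f2] to elements
    [P, Q] with [P^2 = rs] and [PQ + QP = rs].  So [C_0(phi)] is a quaternion
    algebra over a copy of [K]; as [P^2 = (XY)^2], the element [P - XY] is
    nilpotent, and with [Q] it produces a system of 2 x 2 matrix units
    ([quaternion_iso]).  Finally, [K] has a unique embedding in the centre,
    because every element of [K] has its square in [F] and the centre is
    reduced; this settles arbitrary [K]-structures ([quaternion_split]). *)

Set Implicit Arguments.
Unset Strict Implicit.
Unset Printing Implicit Defensive.

Import GRing.Theory.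
Local Open Scope ring_scope.

(** * Polar forms and characteristic 2 *)

Lemma pchar2D (F : fieldType) : 2%N \in [pchar F] -> 1 + 1 = 0 :> F.
Proof. by move/pcharf0. Qed.

Lemma pchar2_addvv (F : fieldType) (V : lmodType F) (v : V) :
  2%N \in [pchar F] -> v + v = 0.
Proof. by move=> F2; rewrite -[v]scale1r -scalerDl pchar2D // scale0r. Qed.

Section Polar.
Variables (F : fieldType) (phi : quadForm F).
Local Notation q := (qval phi).
Local Notation b := (polar (qval phi)).
Implicit Types (u v w : phi) (a : F).

Lemma qvalZ a v : q (a *: v) = a ^+ 2 * q v.
Proof. exact: (qvalP phi).1. Qed.

Lemma qval0 : q 0 = 0.
Proof. by rewrite -(scale0r 0) qvalZ expr0n mul0r. Qed.

Lemma qvalD u v : q (u + v) = q u + q v + b u v.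
Proof. by rewrite /polar; ring. Qed.

Lemma polarC u v : b u v = b v u.
Proof. by rewrite /polar (addrC u); ring. Qed.

Lemma polarDl u v w : b (u + v) w = b u w + b v w.
Proof. by rewrite -[u]scale1r (qvalP phi).2 mul1r scale1r. Qed.

Lemma polar0l w : b 0 w = 0.
Proof. by rewrite /polar add0r qval0 subr0 subrr. Qed.

Lemma polarZl a u w : b (a *: u) w = a * b u w.
Proof. by rewrite -[a *: u]addr0 (qvalP phi).2 polar0l addr0. Qed.

Lemma polarDr u v w : b w (u + v) = b w u + b w v.
Proof. by rewrite polarC polarDl !(polarC w). Qed.

Lemma polarZr a u w : b w (a *: u) = a * b w u.
Proof. by rewrite polarC polarZl polarC. Qed.

Lemma polar0r w : b w 0 = 0.
Proof. by rewrite polarC polar0l. Qed.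

Lemma polar_suml (I : finType) (v : I -> phi) w :
  b (\sum_i v i) w = \sum_i b (v i) w.
Proof.
apply: (big_morph (fun v => b v w)) => [x y|]; first exact: polarDl.
exact: polar0l.
Qed.

Lemma polar_sumr (I : finType) (v : I -> phi) w :
  b w (\sum_i v i) = \sum_i b w (v i).
Proof. by rewrite polarC polar_suml; apply: eq_bigr => i _; rewrite polarC. Qed.

Lemma polarvv v : 2%N \in [pchar F] -> b v v = 0.
Proof.
move=> F2; rewrite /polar pchar2_addvv // qval0 sub0r -opprD.
by rewrite (pchar2_addvv (q v : F^o)) // oppr0.
Qed.

End Polar.

Lemma polar_qperp (F : fieldType) (phi psi : quadForm F) (v w : qperp phi psi) :
  polar (qval (qperp phi psi)) v w =
  polar (qval phi) v.1 w.1 + polar (qval psi) v.2 w.2.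
Proof. by rewrite /polar /=; ring. Qed.

Definition nondegenerate_form (F : fieldType) (psi : quadForm F) : Prop :=
  forall v : psi, (forall w, polar (qval psi) v w = 0) -> v = 0.

(** * Composition of octonion norms *)
Definition is_composition (F : fieldType) (psi : quadForm F)
    (mul : psi -> psi -> psi) (e : psi) : Prop :=
  [/\ (forall v, linear (mul v)), (forall v, linear (mul^~ v)),
      left_id e mul, right_id e mul
    & forall v w, qval psi (mul v w) = qval psi v * qval psi w].

Section CayleyDickson.
Variable F : fieldType.

Definition cd_form (a : F) (psi : quadForm F) := qperp psi (qscale a psi).

(** The signs are those for which the norm of a pair [(p, q)] is
    [n(p) + a n(q)], so that multiplicativity is an identity over any
    commutative ring and the product fits Pfister forms as they stand. *)
Definition cd_mul (V : lmodType F) (mul : V -> V -> V) (conj : V -> V) (a : F)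
    (x y : V * V) : V * V :=
  (mul x.1 y.1 - a *: mul (conj y.2) x.2, mul y.2 x.1 + mul x.2 (conj y.1)).

Definition cd_conj (V : lmodType F) (conj : V -> V) (x : V * V) : V * V :=
  (conj x.1, - x.2).

Lemma cd_nondegenerate a psi :
  a != 0 -> nondegenerate_form psi -> nondegenerate_form (cd_form a psi).
Proof.
move=> a0 ndg [u v] uv0; congr pair.
  apply: ndg => w; have := uv0 (w, 0).
  by rewrite /polar /= addr0 qval0 => <-; ring.
apply: ndg => w; apply: (mulfI a0); rewrite mulr0 -(uv0 (0, w)).
by rewrite /polar /= addr0 qval0; ring.
Qed.

Variable c : F.
Local Notation E := (F^o * F^o)%type.

(** Multiplication of [x + y w] in the algebra generated by [w] with
    [w^2 = w - c], whose norm is [x^2 + x y + c y^2]; conjugation sends [w] to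
    [1 - w]. *)
Definition quad_mul (x y : E) : E :=
  (x.1 * y.1 - c * (x.2 * y.2), x.1 * y.2 + x.2 * y.1 + x.2 * y.2).

Definition quad_conj (x : E) : E := (x.1 + x.2, - x.2).

Lemma qbin_nondegenerate a : 2%N \in [pchar F] -> nondegenerate_form (qbin a c).
Proof.
move=> /pchar2D F2 [x y] xy0.
have /= := xy0 (1, 0); have /= := xy0 (0, 1); rewrite /polar /= => ex ey.
have F2M (z : F) : (1 + 1) * z = 0 by rewrite F2 mul0r.
congr pair; first by rewrite -[LHS]addr0 -[X in _ + X](F2M (c * y)) -ex; ring.
by rewrite -[LHS]addr0 -[X in _ + X](F2M (a * x)) -ey; ring.
Qed.

Definition oct_form (a1 a2 : F) := cd_form a1 (cd_form a2 (qbin 1 c)).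

Lemma quad_ext (x y : E) : x.1 = y.1 -> x.2 = y.2 -> x = y.
Proof. by case: x y => [? ?] [? ?] /= -> ->. Qed.

Lemma oct_ext (x y : ((E * E) * (E * E))%type) :
  x.1.1 = y.1.1 -> x.1.2 = y.1.2 -> x.2.1 = y.2.1 -> x.2.2 = y.2.2 -> x = y.
Proof. by case: x y => [[? ?] [? ?]] [[? ?] [? ?]] /= -> -> -> ->. Qed.

(** In coordinates, the multiplicativity of the octonion norm is Degen's
    eight-square identity twisted by [a1], [a2] and [c]. *)
Lemma oct_composition a1 a2 :
  exists mul e, is_composition (psi := oct_form a1 a2) mul e.
Proof.
exists (cd_mul (cd_mul quad_mul quad_conj a2) (cd_conj quad_conj) a1).
exists (((1 : F^o, 0 : F^o), 0), 0); split.
- case=> [[[x1 x2] [x3 x4]] [[x5 x6] [x7 x8]]] k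
    [[[y1 y2] [y3 y4]] [[y5 y6] [y7 y8]]] [[[z1 z2] [z3 z4]] [[z5 z6] [z7 z8]]].
  by apply: oct_ext; apply: quad_ext; rewrite /= /GRing.scale /=; ring.
- case=> [[[x1 x2] [x3 x4]] [[x5 x6] [x7 x8]]] k
    [[[y1 y2] [y3 y4]] [[y5 y6] [y7 y8]]] [[[z1 z2] [z3 z4]] [[z5 z6] [z7 z8]]].
  by apply: oct_ext; apply: quad_ext; rewrite /= /GRing.scale /=; ring.
- case=> [[[x1 x2] [x3 x4]] [[x5 x6] [x7 x8]]].
  by apply: oct_ext; apply: quad_ext; rewrite /= /GRing.scale /=; ring.
- case=> [[[x1 x2] [x3 x4]] [[x5 x6] [x7 x8]]].
  by apply: oct_ext; apply: quad_ext; rewrite /= /GRing.scale /=; ring.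
- case=> [[[x1 x2] [x3 x4]] [[x5 x6] [x7 x8]]].
  case=> [[[y1 y2] [y3 y4]] [[y5 y6] [y7 y8]]].
  by rewrite /= /GRing.scale /=; ring.
Qed.

End CayleyDickson.

(** * Dominance and dimensions *)
Section Dominated.
Variable F : fieldType.
Implicit Types phi psi pi : quadForm F.

Lemma isometric_dominated phi psi : isometric phi psi -> dominated phi psi.
Proof. by case=> f [/bij_inj finj fq]; exists f. Qed.

Lemma dominated_trans phi psi pi :
  dominated phi psi -> dominated psi pi -> dominated phi pi.
Proof.
move=> [f [finj fq]] [g [ginj gq]]; exists (g \o f); split.
  exact: inj_comp.
by move=> v; rewrite fq gq.
Qed.

Lemma dominated_qdim phi psi : dominated phi psi -> (qdim phi <= qdim psi)%N.
Proof.
move=> [f [finj _]]; rewrite /qdim -(@limg_dim_eq _ _ _ (linfun f)).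
  exact: dimvS (subvf _).
rewrite capfv; apply/eqP/lker0P => u v; rewrite !lfunE; exact: finj.
Qed.

Lemma isometric_sym phi psi : isometric phi psi -> isometric psi phi.
Proof.
move=> [f [[g fK gK] fq]].
have glin : linear g.
  by move=> a u v; apply: (can_inj fK); rewrite linearP !gK.
pose gL := GRing.isLinear.Build F _ _ _ g glin.
pose g' : {linear psi -> phi} := HB.pack g gL.
exists g'; split; first by exists f.
by move=> v; rewrite fq /= gK.
Qed.

Lemma isometric_qdim phi psi : isometric phi psi -> qdim phi = qdim psi.
Proof.
move=> iso; apply/eqP; rewrite eqn_leq; apply/andP; split.
  exact/dominated_qdim/isometric_dominated.
exact/dominated_qdim/isometric_dominated/isometric_sym.
Qed.

Lemma dominated_isometric phi psi :
  dominated phi psi -> (qdim psi <= qdim phi)%N -> isometric psi phi.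
Proof.
move=> [f [finj fq]] dimle.
have ker0 : lker (linfun f) == 0%VS.
  by apply/lker0P => u v; rewrite !lfunE; apply: finj.
have img : limg (linfun f) = fullv.
  apply/eqP; rewrite eqEdim subvf limg_dim_eq //.
  by rewrite (eqP ker0) capv0.
pose g := (linfun f)^-1%VF.
have fg : cancel g f.
  by move=> v; rewrite -(lfunE f) limg_lfunVK // img memvf.
exists g; split; last by move=> v; rewrite fq fg.
by exists f => // v; apply: finj; rewrite fg.
Qed.

Lemma qdim_perps (s : seq (quadForm F)) :
  qdim (qperps s) = sumn [seq qdim phi | phi <- s].
Proof.
by elim: s => [|phi s IHs]; rewrite /= -?IHs /qdim ?dimvf.
Qed.

Lemma qdim_pfister (a : seq F) c : qdim (pfister a c) = (2 ^ (size a).+1)%N.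
Proof.
have sz : size (pfisterb a) = (2 ^ size a)%N.
  by elim: a => //= x a IHa; rewrite size_allpairs IHa -expnS.
rewrite /pfister /bmul qdim_perps -map_comp expnSr -sz.
elim: (pfisterb a) => //= x d ->.
by rewrite mulSn; congr addn; rewrite /qdim dimvf.
Qed.

(** Stated for an abstract form and abstract coefficients: the coordinate space
    then never has to be unfolded, and the diagonal of the Pfister form may
    carry its literal products with 1. *)
Lemma perps4_cd_form (psi : quadForm F) (a1 a2 d1 d2 d3 d4 : F) :
    d1 = 1 -> d2 = a2 -> d3 = a1 -> d4 = a1 * a2 ->
  dominated (qperps [seq qscale x psi | x <- [:: d1; d2; d3; d4]])
    (cd_form a1 (cd_form a2 psi)).
Proof.
move=> e1 e2 e3 e4.
pose f (v : (psi * (psi * (psi * (psi * 'rV[F]_0))))%type) :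
  ((psi * psi) * (psi * psi))%type :=
  ((v.1, v.2.1), (v.2.2.1, v.2.2.2.1)).
have flin : linear f by move=> k u v.
pose fL := GRing.isLinear.Build F _ _ _ f flin.
pose g : {linear _ -> _} := HB.pack f fL.
exists g; split.
  move=> [u1 [u2 [u3 [u4 u5]]]] [v1 [v2 [v3 [v4 v5]]]].
  case=> -> -> -> ->.
  by do !congr pair; rewrite (thinmx0 u5) (thinmx0 v5).
move=> [u1 [u2 [u3 [u4 u5]]]].
by rewrite /= big_ord0 e1 e2 e3 e4; ring.
Qed.

Lemma pfister_oct (a1 a2 c : F) :
  dominated (pfister [:: a1; a2] c) (oct_form c a1 a2).
Proof. by apply: perps4_cd_form; ring. Qed.

End Dominated.

(** * The codimension of an orthogonal space *)

(** Pairing with a basis of [U] gives a map onto a space of dimension [\dim U],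
    because the Gram matrix [B] has full rank when the polar form is
    nondegenerate.  Its kernel is the orthogonal of [U], which therefore has the
    dimension of its subspace [W]. *)
Lemma orthogonal_complement (F : fieldType) (psi : quadForm F)
    (U W : {vspace psi}) (z : psi) :
  nondegenerate_form psi ->
  (forall u w, u \in U -> w \in W -> polar (qval psi) u w = 0) ->
  (\dim U + \dim W = qdim psi)%N ->
  (forall u, u \in U -> polar (qval psi) u z = 0) -> z \in W.
Proof.
move=> ndg UW dimUW Uz; set b := polar (qval psi) in UW Uz.
pose e := vbasis {: psi}; pose t := vbasis U.
pose B := \matrix_(k < \dim {: psi}, i < \dim U) b t`_i e`_k.
have fullB : row_full B.
  rewrite /row_full -mxrank_tr; apply: inj_row_free => v vB.
  have t0 : \sum_(i < \dim U) v 0 i *: t`_i = 0.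
    apply: ndg => w; rewrite (coord_vbasis (memvf w)) polar_sumr.
    apply: big1 => k _; rewrite polarZr polar_suml.
    suff -> : \sum_i polar (qval psi) (v 0 i *: t`_i) e`_k = 0 by rewrite mulr0.
    have /rowP /(_ k) := vB; rewrite !mxE; apply: etrans.
    by apply: eq_bigr => i _; rewrite polarZl !mxE.
  apply/rowP => i; rewrite mxE.
  by have /freeP /(_ (fun i => v 0 i) t0 i) := basis_free (vbasisP U).
pose beta0 (v : psi) : 'rV[F]_(\dim U) := \row_i b t`_i v.
have beta_lin : linear beta0.
  by move=> a u v; apply/rowP=> i; rewrite !mxE /b polarDr polarZr.
pose betaL := GRing.isLinear.Build F _ _ _ beta0 beta_lin.
pose beta : {linear psi -> 'rV[F]_(\dim U)} := HB.pack beta0 betaL.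
have img : limg (linfun beta) = fullv.
  apply/eqP; rewrite eqEsubv subvf; apply/subvP => r _.
  pose u := r *m pinvmx B.
  suff -> : r = linfun beta (\sum_k u 0 k *: e`_k) by rewrite memv_img ?memvf.
  have uB : u *m B = r by rewrite mulmxKpV ?submx_full.
  rewrite lfunE; apply/rowP => i; rewrite -[r]uB !mxE /b polar_sumr.
  by apply: eq_bigr => k _; rewrite polarZr [B _ _]mxE.
have inker v : (forall u, u \in U -> b u v = 0) -> v \in lker (linfun beta).
  move=> Uv; rewrite memv_ker lfunE; apply/eqP/rowP => i; rewrite !mxE.
  by apply/Uv/vbasis_mem/mem_nth; rewrite size_tuple.
suff -> : W = lker (linfun beta) by apply: inker.
apply/eqP; rewrite eqEdim; apply/andP; split.
  by apply/subvP => w Ww; apply: inker => u Uu; apply: UW.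
have := limg_ker_dim (linfun beta) fullv.
rewrite img capfv dimvf dim_matrix mul1r => dimE.
by move: dimUW; rewrite /qdim -dimE addnC => /addIn <-.
Qed.

(** * Composition algebras *)
Section CompositionTheory.
Variables (F : fieldType) (psi : quadForm F).
Variables (mul : psi -> psi -> psi) (e : psi).
Hypothesis comp : is_composition mul e.
Hypothesis ndg : nondegenerate_form psi.
Local Notation n := (qval psi).
Local Notation b := (polar (qval psi)).
Implicit Types (x y z w : psi) (a : F).

Let op_linr x : linear (mul x). Proof. by case: comp. Qed.
Let op_linl x : linear (mul^~ x). Proof. by case: comp. Qed.
Let op1l : left_id e mul. Proof. by case: comp. Qed.
Let op1r : right_id e mul. Proof. by case: comp. Qed.
Let nM x y : n (mul x y) = n x * n y. Proof. by case: comp. Qed.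

Let opDr x y z : mul x (y + z) = mul x y + mul x z.
Proof. by have := op_linr x 1 y z; rewrite !scale1r. Qed.
Let op0r x : mul x 0 = 0.
Proof. by have := op_linr x (-1) 0 0; rewrite scaler0 addr0 scaleN1r addNr. Qed.
Let opZr x a y : mul x (a *: y) = a *: mul x y.
Proof. by have := op_linr x a y 0; rewrite op0r !addr0. Qed.
Let opDl x y z : mul (y + z) x = mul y x + mul z x.
Proof. by have := op_linl x 1 y z; rewrite !scale1r. Qed.
Let op0l x : mul 0 x = 0.
Proof. by have := op_linl x (-1) 0 0; rewrite scaler0 addr0 scaleN1r addNr. Qed.
Let opZl x a y : mul (a *: y) x = a *: mul y x.
Proof. by have := op_linl x a y 0; rewrite op0l !addr0. Qed.

Lemma comp_polarl x y z : b (mul x y) (mul x z) = n x * b y z.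
Proof. by rewrite /polar -opDr !nM; ring. Qed.

Lemma comp_polarr x y z : b (mul y x) (mul z x) = b y z * n x.
Proof. by rewrite /polar -opDl !nM; ring. Qed.

(** The full linearization of [n (x y) = n x * n y]; with [e] among the four
    vectors it computes the polar product of [x y] with [e] and of [x x] with
    any vector. *)
Lemma comp_polar2 x y z w :
  b (mul x y) (mul z w) + b (mul x w) (mul z y) = b x z * b y w.
Proof.
have := comp_polarl (x + z) y w.
rewrite !opDl !polarDl !polarDr !comp_polarl qvalD (polarC (mul z y)).
move=> /(congr1 (fun t => t - n x * b y w - n z * b y w)) E.
by apply: etrans (etrans E _); ring.
Qed.

(** The norm may vanish on nonzero vectors, so injectivity comes from the polar
    form, which multiplication by [x] rescales by [n x]. *)
Lemma comp_mul_inj x y : n x != 0 -> mul x y = 0 -> y = 0.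
Proof.
move=> nx xy0; apply: ndg => z; apply: (mulfI nx).
by rewrite -comp_polarl xy0 polar0l mulr0.
Qed.

(** The map is the given embedding followed by the inverse of multiplication by
    the image of [g0]; the norm of that image absorbs the factor [alpha]. *)
Lemma comp_translate (phi : quadForm F) (alpha : F) (g0 : phi) :
  alpha != 0 -> dominated (qscale alpha phi) psi -> qval phi g0 != 0 ->
  exists sigma : {linear phi -> psi},
    [/\ injective sigma, sigma g0 = e
      & forall v, n (sigma v) = qval phi v / qval phi g0].
Proof.
move=> alpha0 [f [finj /= fq]] g00.
have nf0 : n (f g0) != 0 by rewrite -fq mulf_neq0.
pose lL := GRing.isLinear.Build F _ _ _ (mul (f g0)) (op_linr (f g0)).
have [L LE] : exists L : {linear psi -> psi}, L =1 mul (f g0).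
  by exists (HB.pack_for {linear psi -> psi} (mul (f g0)) lL).
have kerL : lker (linfun L) = 0%VS.
  apply/eqP/lker0P => u v; rewrite !lfunE => /eqP.
  rewrite -subr_eq0 -linearB LE => /eqP /(comp_mul_inj nf0) /eqP.
  by rewrite subr_eq0 => /eqP.
have LK v : mul (f g0) ((linfun L)^-1%VF v) = v.
  rewrite -LE -(lfunE L) limg_lfunVK //.
  suff -> : limg (linfun L) = fullv by rewrite memvf.
  by apply/eqP; rewrite eqEdim subvf limg_dim_eq ?kerL ?capv0 /=.
pose sigma : {linear phi -> psi} := (linfun L)^-1%VF \o f.
exists sigma; split.
- by move=> u v uv; apply: finj; rewrite -[LHS]LK -[RHS]LK [_ (f u)]uv.
- apply/eqP; rewrite -subr_eq0; apply/eqP/(comp_mul_inj nf0).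
  by rewrite -scaleN1r opDr opZr LK op1r scaleN1r subrr.
- by move=> v; apply: (mulfI nf0); rewrite -nM LK -!fq /=; field; rewrite g00.
Qed.

Lemma comp_product x y :
  b e x = 0 -> b e y = 0 -> b x y = 0 ->
  [/\ b (mul x y) e = 0, b (mul x y) x = 0 & b (mul x y) y = 0].
Proof.
move=> ex ey xy; split.
- have := comp_polar2 x y e e.
  by rewrite !op1l !op1r xy addr0 (polarC x) ex mul0r.
- by rewrite -{2}[x]op1r comp_polarl polarC ey mulr0.
- by rewrite -{2}[y]op1l comp_polarr polarC ex mul0r.
Qed.

Lemma comp_sqr x : b x e = 0 -> mul x x = (- n x) *: e.
Proof.
move=> xe; apply/eqP; rewrite -subr_eq0 -scaleNr opprK; apply/eqP/ndg => w.
have := comp_polar2 x x e w; have := comp_polarl x w e.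
by rewrite xe mul0r !op1l op1r polarDl polarZl (polarC e) => <-.
Qed.

(** If the product were a combination of [e, x, y], then some shifts [x'] and
    [y'] of [x] and [y] by multiples of [e] would have a product in [F e].  As
    [x' x'] is [- n x'] times [e], cancelling [x'] makes [y'] a multiple of
    [x'], against the independence of [e, x, y]. *)
Lemma comp_product_notin x y (a0 a1 a2 : F) :
    b e x = 0 -> b e y = 0 -> b x y = 0 -> b e e = 0 ->
    (forall c0 c1 c2, n (c0 *: e + c1 *: x + c2 *: y) = 0 ->
       [/\ c0 = 0, c1 = 0 & c2 = 0]) ->
  mul x y <> a0 *: e + a1 *: x + a2 *: y.
Proof.
move=> ex ey xy ee aniso exy.
pose x' := (- a2) *: e + x; pose y' := (- a1) *: e + y.
have nx' : n x' != 0.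
  apply/eqP => nx0.
  have [|_ /eqP] := aniso (- a2) 1 0; last by rewrite oner_eq0.
  by rewrite scale1r scale0r addr0.
have x'x' : mul x' x' = (- n x') *: e.
  by apply: comp_sqr; rewrite polarDl polarZl ee mulr0 add0r polarC.
have x'y' : mul x' y' = (a0 + a1 * a2) *: e.
  rewrite opDr opZr op1r opDl opZl op1l exy /x'.
  rewrite scalerDr scalerA mulrNN !scaleNr [_ + a2 *: y]addrC addKr.
  by rewrite addrACA addNr addr0 addrC -scalerDl.
have: mul x' (n x' *: y' + (a0 + a1 * a2) *: x') = 0.
  by rewrite opDr !opZr x'x' x'y' !scalerA -scalerDl mulrN mulrC subrr scale0r.
move=> /(comp_mul_inj nx') lin0.
pose d := a0 + a1 * a2.
have [|_ _ /eqP] := aniso (- a1 * n x' - d * a2) d (n x').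
  rewrite -(qval0 psi) -lin0 /x' /y'; congr n.
  rewrite -/x' -/d; move: (n x') => N.
  rewrite /x' !scalerDr !scalerA [RHS]addrACA -scalerDl [RHS]addrA addrAC.
  by congr (_ *: _ + _ + _); ring.
by rewrite (negPf nx').
Qed.

End CompositionTheory.

(** * The normal form of the neighbor *)
Lemma polar_qdiag (F : fieldType) (c : seq F) (z w : qdiag c) :
  2%N \in [pchar F] -> polar (qval (qdiag c)) z w = 0.
Proof.
move=> /pchar2D F2; rewrite /polar /= -!sumrB; apply: big1 => i _; rewrite mxE.
transitivity ((1 + 1) * (c`_i * z 0 i * w 0 i)); first by ring.
by rewrite F2 mul0r.
Qed.

(** The radical is the diagonal part: in characteristic 2 its polar form
    vanishes, while that of the binary part is nondegenerate. *)
Lemma type13_radical (F : fieldType) (phi : quadForm F) :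
  2%N \in [pchar F] -> of_type 1 3 phi ->
  qdim phi = 5%N /\ exists2 R : {vspace phi}, \dim R = 3%N &
    forall v, v \in R <-> forall w, polar (qval phi) v w = 0.
Proof.
move=> F2 [ab [c]]; case: ab => [[|[a b] [|? ?]] //= _].
have := size_tuple c; move: (tval c) => {}c sc iso.
split.
  rewrite (isometric_qdim iso) /qdim dimvf.
  by rewrite -[LHS]/(2 + (1 * 0) + (1 * size c))%N sc.
have [f [[g fK gK] fq]] := isometric_sym iso.
have fp x y : polar (qval phi) (f x) (f y) = polar (qval _) x y.
  by rewrite /polar -linearD -!fq.
pose h0 (z : 'rV[F]_(size c)) : phi := f ((0 : qperps [:: qbin a b]), z).
have h0lin : linear h0.
  move=> k u v; rewrite /h0 -linearP; congr (f _); congr pair.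
  by rewrite /= scaler0 addr0.
have [h hE] : exists h : {linear 'rV[F]_(size c) -> phi}, h =1 h0.
  pose hL := GRing.isLinear.Build F _ _ _ h0 h0lin.
  by exists (HB.pack_for {linear 'rV[F]_(size c) -> phi} h0 hL).
have kerh : lker (linfun h) = 0%VS.
  apply/eqP/lker0P => u v; rewrite !lfunE /= !hE.
  by move=> /(can_inj fK) [].
exists (limg (linfun h)).
  by rewrite limg_dim_eq ?kerh ?capv0 // dimvf dim_matrix mul1r.
move=> v; split.
  case/memv_imgP => z _ ->; rewrite lfunE /= hE /h0 => w.
  by rewrite -[w]gK fp polar_qperp polar0l add0r polar_qdiag.
move=> v0; rewrite -[v]gK.
have := gK v; case: (g v) => -[p p'] z vE.
have p0 : p = 0.
  apply: (qbin_nondegenerate F2) => q.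
  rewrite -[RHS](v0 (f ((q, 0), 0))) -vE fp !polar_qperp.
  by rewrite (polar0r (phi := qdiag c)) (polar0r (phi := qdiag [::])) !addr0.
rewrite p0 (thinmx0 p') -[f _]hE -(lfunE h).
exact: memv_img (memvf _).
Qed.

(** A frame of five vectors with the right values and polar products gives an
    isometric embedding of the normal form, which is onto by dimension.  It is
    injective since [d != 0] detects the coordinates on [f1] and [f2]. *)
Lemma frame_isometric (F : fieldType) (phi : quadForm F)
    (f1 f2 g0 g1 g2 : phi) (k r s u : F) (d := k * (r * s)) :
    2%N \in [pchar F] -> qdim phi = 5%N -> d != 0 ->
    polar (qval phi) f1 f2 = d -> qval phi f1 = d -> qval phi f2 = d * u ->
    qval phi g0 = k -> qval phi g1 = k * r -> qval phi g2 = k * s ->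
    (forall v, polar (qval phi) g0 v = 0) ->
    (forall v, polar (qval phi) g1 v = 0) ->
    (forall v, polar (qval phi) g2 v = 0) ->
    (forall c0 c1 c2, c0 *: g0 + c1 *: g1 + c2 *: g2 = 0 ->
       [/\ c0 = 0, c1 = 0 & c2 = 0]) ->
  isometric phi
    (qscale k (qperp (qscale (r * s) (qbin 1 u)) (qdiag [:: 1; r; s]))).
Proof.
move=> F2 dim5 d0 f12 qf1 qf2 qg0 qg1 qg2 rad0 rad1 rad2 freeg.
apply: dominated_isometric; last first.
  by rewrite dim5 /qdim dimvf.
pose tau0 (v : ((F^o * F^o) * 'rV[F]_3)%type) : phi :=
  (v.1.1 *: f1 + v.1.2 *: f2) + \sum_(i < 3) v.2 0 i *: [:: g0; g1; g2]`_i.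
have tlin : linear tau0.
  move=> h v v'; rewrite /tau0.
  under eq_bigr do rewrite !mxE scalerDl -scalerA.
  rewrite big_split /= -scaler_sumr.
  have sE (a3 b3 : F) : a3 *: (b3 : F^o) = a3 * b3 by [].
  rewrite /= !sE !scalerDl -!scalerA (addrACA (h *: _)) [LHS]addrACA.
  by rewrite -!scalerDr.
have [tau tauE] : exists tau : {linear ((F^o * F^o) * 'rV[F]_3)%type -> phi},
    tau =1 tau0.
  pose tL := GRing.isLinear.Build F _ _ _ tau0 tlin.
  by exists (HB.pack_for {linear ((F^o * F^o) * 'rV[F]_3)%type -> phi} tau0 tL).
have radS (c0 : 'I_3 -> F) v :
    polar (qval phi) (\sum_i c0 i *: [:: g0; g1; g2]`_i) v = 0.
  rewrite !big_ord_recl big_ord0 /= !polarDl !polarZl polar0l.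
  by rewrite rad0 rad1 rad2 !mulr0 !addr0.
exists tau; split; last first.
  case=> [[x1 x2] v]; rewrite tauE /tau0 /= (qvalD _ (\sum_i _)) polarC radS.
  rewrite qvalD polarZl polarZr f12 !qvalZ qf1 !big_ord_recl !big_ord0 /=.
  rewrite !qvalD !qvalZ qval0 !polarDr !polarZl !polarZr !polar0r.
  by rewrite !rad0 !rad1 !mulr0 !addr0 qf2 qg0 qg1 qg2 /d; ring.
apply: raddf_inj => v' /= v0; have {}v0 : tau0 v' = 0 by rewrite -tauE.
have v1 : v'.1.1 = 0.
  apply: (mulIf d0); rewrite mul0r -(polar0l f2) -v0 /tau0 polarDl radS.
  by rewrite polarDl !polarZl f12 polarvv // mulr0 !addr0.
have v2 : v'.1.2 = 0.
  apply: (mulIf d0); rewrite mul0r -(polar0l f1) -v0 /tau0 polarDl radS.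
  by rewrite polarDl !polarZl (polarC f2) f12 polarvv // mulr0 add0r addr0.
move: v0; rewrite /tau0 v1 v2 !scale0r !add0r !big_ord_recl big_ord0 /= addr0.
rewrite addrA => /freeg [z0 z1 z2].
case: v' v1 v2 z0 z1 z2 => [[x1 x2] v'] /= -> -> z0 z1 z2; congr pair.
apply/rowP => i; rewrite mxE.
case: (unliftP 0 i) => [{}i|] ->; last exact: z0.
case: (unliftP 0 i) => [{}i|] ->; last exact: z1.
by rewrite (ord1 i).
Qed.

(** The scalar is the value of [phi] at the radical vector [g0] that is moved to
    the unit of the octonions. *)
Lemma neighbor_normal_form (F : fieldType) (phi : quadForm F) :
  2%N \in [pchar F] -> anisotropic phi -> of_type 1 3 phi ->
  pfister_neighbor phi ->
  exists r s u alpha : F, [/\ r != 0, s != 0, u != 0, alpha != 0 &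
    isometric phi
      (qscale alpha (qperp (qscale (r * s) (qbin 1 u)) (qdiag [:: 1; r; s])))].
Proof.
move=> F2 aniso t13 [pi [beta [[a [c [a0 piE]]] beta0 dom dimlt]]].
have [dim5 [R dimR inR]] := type13_radical F2 t13.
have := isometric_qdim piE; rewrite qdim_pfister => dimpi.
have := dominated_qdim dom; rewrite [qdim (qscale _ _)]dim5.
move: dimlt; rewrite dim5 dimpi.
(* 5 <= 2 ^ (size a).+1 < 10 leaves only [size a = 2] *)
case: a a0 piE {dimpi} => [|a1 [|a2 [|a3 a]]] //= a0 piE; last first.
  by move=> /(leq_ltn_trans (@leq_pexp2l 2 4 (size a).+4 isT isT)).
move=> _ _; case/and3P: a0 => a10 a20 _.
have {piE}dom : dominated (qscale beta phi) (oct_form c a1 a2).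
  apply: dominated_trans dom (dominated_trans (isometric_dominated piE) _).
  exact: pfister_oct.
have ndg : nondegenerate_form (oct_form c a1 a2).
  by do 2!apply: cd_nondegenerate => //; apply: qbin_nondegenerate.
have [mul [e comp]] := oct_composition c a1 a2.
have dim8 : qdim (oct_form c a1 a2) = 8 by rewrite /qdim dimvf.
move: (oct_form c a1 a2) ndg mul e comp dim8 dom => psi ndg mul e comp dim8 dom.
have [g0 [g1 [g2 gR]]] : exists g0 g1 g2, basis_of R [:: g0; g1; g2].
  have := vbasisP R; have := etrans (size_tuple (vbasis R)) dimR.
  by case: (tval _) => [|g0 [|g1 [|g2 []]]] // _ bR; exists g0, g1, g2.
have spanR v : v \in R -> exists c0 c1 c2,
    v = c0 *: g0 + c1 *: g1 + c2 *: g2.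
  rewrite -(span_basis gR) !span_cons span_nil addv0.
  case/memv_addP => _ /vlineP[c0 ->] [v' v'P ->].
  case/memv_addP: v'P => _ /vlineP[c1 ->] [_ /vlineP[c2 ->] ->].
  by exists c0, c1, c2; rewrite addrA.
have freeR c0 c1 c2 : c0 *: g0 + c1 *: g1 + c2 *: g2 = 0 ->
    [/\ c0 = 0, c1 = 0 & c2 = 0].
  move=> comb0; have /= /freeP := basis_free gR.
  move=> /(_ (fun i => [:: c0; c1; c2]`_i)) /= c00.
  have ci i : [:: c0; c1; c2]`_(i : 'I_3) = 0.
    by apply: c00; rewrite !big_ord_recl big_ord0 /= addr0 addrA.
  by split; [exact: (ci 0) | exact: (ci 1) | exact: (ci (1 + 1))].
have [Rg0 Rg1 Rg2] : [/\ g0 \in R, g1 \in R & g2 \in R].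
  by split; apply: (basis_mem gR); rewrite !inE eqxx ?orbT.
have [k0 n10 n20] : [/\ qval phi g0 != 0, qval phi g1 != 0 & qval phi g2 != 0].
  by split; apply/eqP => /aniso g00; [have [|/eqP] := freeR 1 0 0
    | have [|_ /eqP] := freeR 0 1 0 | have [|_ _ /eqP] := freeR 0 0 1];
    rewrite ?oner_eq0 // g00 !scale0r !scaler0 ?addr0 ?add0r.
have [sigma [sinj sg0 sq]] := comp_translate comp ndg beta0 dom k0.
set k := qval phi g0 in k0 sq.
have sp u v : polar (qval psi) (sigma u) (sigma v) = polar (qval phi) u v / k.
  by rewrite /polar -linearD !sq !mulrBl.
pose x := sigma g1; pose y := sigma g2; pose z := mul x y.
have orth u v : u \in R -> polar (qval psi) (sigma u) (sigma v) = 0.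
  by move=> /inR Ru; rewrite sp Ru mul0r.
have ex : polar (qval psi) e x = 0 by rewrite -sg0 orth.
have ey : polar (qval psi) e y = 0 by rewrite -sg0 orth.
have xy : polar (qval psi) x y = 0 by rewrite orth.
have [ze zx zy] := comp_product comp ex ey xy.
have ker0 : lker (linfun sigma) = 0%VS.
  by apply/eqP/lker0P => u v; rewrite !lfunE; apply: sinj.
(* dimensions: 3 for the radical and 5 for [phi], out of 8 *)
have: z \in limg (linfun sigma).
  apply: (@orthogonal_complement _ _ (linfun sigma @: R)) => //.
  - move=> _ _ /memv_imgP[u Ru ->] /memv_imgP[w _ ->].
    by rewrite !lfunE orth.
  - rewrite !limg_dim_eq ?ker0 ?capv0 // dimR.
    by rewrite -[\dim _]/(qdim phi) dim5 dim8.
  move=> _ /memv_imgP[u /spanR[c0 [c1 [c2 ->]]] ->].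
  rewrite lfunE /= !linearD !linearZ /= sg0 !polarDl !polarZl !(polarC _ z).
  by rewrite ze zx zy !mulr0 !addr0.
case/memv_imgP => f1 _; rewrite lfunE /= => zE.
have f1R : ~~ (f1 \in R).
  apply/negP => /spanR [c0 [c1 [c2 f1E]]].
  apply: (@comp_product_notin _ _ mul e comp ndg x y c0 c1 c2) => //.
  - exact: polarvv.
  - move=> d0 d1 d2; rewrite -sg0 -!linearZ -!linearD sq => /eqP.
    by rewrite mulf_eq0 invr_eq0 (negPf k0) orbF => /eqP /aniso /freeR.
  by rewrite -/z zE f1E !linearD !linearZ /= sg0.
have [w tw] : exists w, polar (qval phi) f1 w <> 0.
  by apply/existsNP => f10; move/negP: f1R; apply; apply/inR.
have [t tE] : exists t, polar (qval phi) f1 w = t by eexists.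
have t0 : t != 0 by rewrite -tE; apply/eqP.
pose r := qval phi g1 / k; pose s := qval phi g2 / k; pose d := k * (r * s).
have r0 : r != 0 by rewrite mulf_neq0 ?invr_eq0.
have s0 : s != 0 by rewrite mulf_neq0 ?invr_eq0.
have d0 : d != 0 by rewrite mulf_neq0 // mulf_neq0.
have qf1 : qval phi f1 = d.
  apply: (mulIf (invr_neq0 k0)); rewrite -sq -zE.
  have [_ _ _ _ ->] := comp.
  by rewrite !sq /d -/r -/s; field.
(* the polar product of [rs[1, u]] on its basis is [rs] *)
have [f2 f12] : exists f2, polar (qval phi) f1 f2 = d.
  by exists ((d / t) *: w); rewrite polarZr tE; field.
pose u := qval phi f2 / d.
have u0 : u != 0.
  rewrite mulf_neq0 ?invr_eq0 //; apply/eqP => /aniso f20.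
  by move: f12; rewrite f20 polar0r => /esym/eqP; rewrite (negPf d0).
exists r, s, u, k; split=> //.
apply: (@frame_isometric _ _ f1 f2 g0 g1 g2) => //; try exact/inR.
- by rewrite mulrC divfK.
- by rewrite mulrC divfK.
- by rewrite mulrC divfK.
Qed.

(** * Matrix units from a nilpotent element *)
Section MatrixUnits.
Variables (K : fieldType) (A : nzRingType) (iota : {rmorphism K -> A}).
Hypothesis iotaC : forall k a, iota k * a = a * iota k.
Variables N Q : A.
Hypotheses (NN : N * N = 0) (NQ : N * Q + Q * N = 1).
Hypothesis QQC : GRing.comm N (Q ^+ 2).

(** [N Q] and [Q N] are complementary idempotents, and [N] and [Q N Q] are the
    off-diagonal units; one formula covers the four. *)
Definition mx_unit (i j : 'I_2) : A := Q ^+ i * N * Q ^+ (1 - j).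

(** The middle factor is [N Q^k N] with [k = 1] on matching indices, which gives
    [N]; for [k = 0] and [k = 2] it is zero, as [Q^2] commutes with [N]. *)
Lemma mx_unitM i j k l :
  mx_unit i j * mx_unit k l = if j == k then mx_unit i l else 0.
Proof.
have NQN : N * Q * N = N.
  have /(canRL (addrK _)) -> := NQ.
  by rewrite mulrBl mul1r -mulrA NN mulr0 subr0.
have -> : mx_unit i j * mx_unit k l
        = Q ^+ i * (N * Q ^+ (1 - j + k) * N) * Q ^+ (1 - l).
  by rewrite exprD !mulrA.
case: j k => [[|[|//]] Hj] [[|[|//]] Hk] /=; rewrite /mx_unit ?expr1 ?expr0.
- by rewrite NQN.
- by rewrite -[Q ^+ (_ + _)]/(Q ^+ 2) QQC -(mulrA (Q ^+ 2)) NN !(mulr0, mul0r).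
- by rewrite mulr1 NN mulr0 mul0r.
- by rewrite NQN.
Qed.

Lemma mx_unit_sum : \sum_i mx_unit i i = 1.
Proof.
rewrite !big_ord_recl big_ord0 addr0 -NQ /mx_unit /=.
by rewrite !expr0 !expr1 mul1r mulr1.
Qed.

Definition mx_to_alg (M : 'M[K]_2) : A :=
  \sum_i \sum_j iota (M i j) * mx_unit i j.

Lemma mx_to_alg_zmod : zmod_morphism mx_to_alg.
Proof.
move=> M M'; rewrite /mx_to_alg -sumrB; apply: eq_bigr => i _.
by rewrite -sumrB; apply: eq_bigr => j _; rewrite !mxE rmorphB mulrBl.
Qed.

Lemma mx_to_alg_scalar k : mx_to_alg k%:M = iota k.
Proof.
rewrite -[RHS]mulr1 -mx_unit_sum mulr_sumr; apply: eq_bigr => i _.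
rewrite (bigD1 i) //= big1 ?addr0 => [|j ne_ji]; first by rewrite mxE eqxx.
by rewrite mxE eq_sym (negPf ne_ji) rmorph0 mul0r.
Qed.

Lemma mx_unit_mul i j M :
  mx_unit i j * mx_to_alg M = \sum_l iota (M j l) * mx_unit i l.
Proof.
rewrite mulr_sumr (bigD1 j) //= [X in _ + X]big1 ?addr0 => [|k ne_kj].
  rewrite mulr_sumr; apply: eq_bigr => l _.
  by rewrite mulrA -iotaC -mulrA mx_unitM eqxx.
rewrite mulr_sumr big1 // => l _.
by rewrite mulrA -iotaC -mulrA mx_unitM eq_sym (negPf ne_kj) mulr0.
Qed.

Lemma mx_to_alg_delta i j : mx_to_alg (delta_mx i j) = mx_unit i j.
Proof.
rewrite /mx_to_alg (bigD1 i) //= [X in _ + X]big1 ?addr0 => [|k ne_ki].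
  rewrite (bigD1 j) //= big1 ?addr0 => [|l ne_lj].
    by rewrite mxE !eqxx rmorph1 mul1r.
  by rewrite mxE (negPf ne_lj) andbF rmorph0 mul0r.
by apply: big1 => l _; rewrite mxE (negPf ne_ki) rmorph0 mul0r.
Qed.

Lemma mx_to_alg_monoid : monoid_morphism mx_to_alg.
Proof.
split=> [|M M']; first by rewrite mx_to_alg_scalar rmorph1.
rewrite [RHS]mulr_suml; apply: eq_bigr => i _.
rewrite mulr_suml.
under [RHS]eq_bigr do rewrite -mulrA mx_unit_mul mulr_sumr.
rewrite exchange_big; apply: eq_bigr => l _.
rewrite !mxE rmorph_sum mulr_suml; apply: eq_bigr => j _.
by rewrite rmorphM mulrA.
Qed.

(** The entries can be read off inside the algebra; this gives injectivity, and
    also shows that central elements of the image are scalars. *)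
Lemma mx_to_alg_entry M i j :
  \sum_k mx_unit k i * mx_to_alg M * mx_unit j k = iota (M i j).
Proof.
rewrite -[RHS]mulr1 -mx_unit_sum mulr_sumr; apply: eq_bigr => k _.
rewrite mx_unit_mul mulr_suml (bigD1 j) //= big1 ?addr0 => [|l ne_lj].
  by rewrite -mulrA mx_unitM eqxx.
by rewrite -mulrA mx_unitM (negPf ne_lj) mulr0.
Qed.

Lemma mx_to_alg_inj : injective mx_to_alg.
Proof.
move=> M M' eqM; apply/matrixP=> i j; apply: (fmorph_inj iota).
by rewrite -!mx_to_alg_entry eqM.
Qed.

Lemma mx_to_alg_central M :
  (forall a, mx_to_alg M * a = a * mx_to_alg M) -> mx_to_alg M = iota (M 0 0).
Proof.
move=> MC; rewrite -mx_to_alg_entry -[LHS]mulr1 -mx_unit_sum mulr_sumr.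
by apply: eq_bigr => i _; rewrite -MC -mulrA mx_unitM eqxx.
Qed.

End MatrixUnits.

(** * The field generated by two square roots *)
Section Biquadratic.
Variables (F : fieldType) (r s : F).
Local Notation quad := ((F^o * F^o) * (F^o * F^o))%type.

Definition biquad_comb (A : algType F) (X Y : A) (q : quad) : A :=
  (q.1.1 *: 1 + q.1.2 *: X) + (q.2.1 *: Y + q.2.2 *: (X * Y)).

Lemma biquad_comb_linear (A : algType F) (X Y : A) : linear (biquad_comb X Y).
Proof.
move=> a q q'; rewrite /biquad_comb /=.
have sE (c d : F) : c *: (d : F^o) = c * d by [].
rewrite !sE !scalerDl -!scalerA !scalerDr.
rewrite (addrACA (a *: (q.1.1 *: 1))) (addrACA (a *: (q.2.1 *: Y))).
by rewrite [LHS]addrACA.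
Qed.

HB.instance Definition _ (A : algType F) (X Y : A) :=
  GRing.isLinear.Build F quad A _ (biquad_comb X Y) (biquad_comb_linear X Y).

Definition biquad_shiftX (q : quad) : quad :=
  ((r * q.1.2, q.1.1), (r * q.2.2, q.2.1)).

Definition biquad_shiftY (q : quad) : quad :=
  ((s * q.2.1, s * q.2.2), (q.1.1, q.1.2)).

(** The product in the commutative algebra presented by [X^2 = r] and
    [Y^2 = s], in coordinates on [1, X, Y, XY]. *)
Definition biquad_mul (p q : quad) : quad :=
  (p.1.1 *: q + p.1.2 *: biquad_shiftX q)
  + (p.2.1 *: biquad_shiftY q + p.2.2 *: biquad_shiftX (biquad_shiftY q)).

Lemma biquad_combM (A : algType F) (X Y : A) :
  X * X = r%:A -> Y * Y = s%:A -> X * Y = Y * X ->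
  forall p q, biquad_comb X Y p * biquad_comb X Y q
              = biquad_comb X Y (biquad_mul p q).
Proof.
move=> XX YY XY p q.
have mulX t : X * biquad_comb X Y t = biquad_comb X Y (biquad_shiftX t).
  rewrite /biquad_comb /= !mulrDr -!scalerAr mulr1 mulrA XX mulr_algl !scalerA.
  by rewrite (addrC (t.1.1 *: X)) (addrC (t.2.1 *: _)) !(mulrC r).
have mulY t : Y * biquad_comb X Y t = biquad_comb X Y (biquad_shiftY t).
  rewrite /biquad_comb /= !mulrDr -!scalerAr mulr1 -XY mulrA -XY -mulrA YY.
  by rewrite mulr_algr !scalerA addrC !(mulrC s).
rewrite [LHS]mulrDl !mulrDl -!scalerAl mul1r -mulrA !(mulX, mulY).
by rewrite -!linearZ -!linearD.
Qed.

Hypothesis F2 : 2%N \in [pchar F].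
Hypothesis rs_indep : forall a b c d : F,
  (a ^+ 2 + r * b ^+ 2) + (s * c ^+ 2 + r * s * d ^+ 2) = 0 ->
  [/\ a = 0, b = 0, c = 0 & d = 0].
Variable (K : fieldExtType F).

Section Generators.
Variables x y : K.
Hypotheses (xx : x * x = r%:A) (yy : y * y = s%:A).

(** Squaring is additive in characteristic 2, so linear independence of
    [1, x, y, xy] follows from anisotropy of the form [<1, r, s, rs>]. *)
Lemma biquad_comb_sqr (q : quad) :
  biquad_comb x y q * biquad_comb x y q =
  ((q.1.1 ^+ 2 + r * q.1.2 ^+ 2) + (s * q.2.1 ^+ 2 + r * s * q.2.2 ^+ 2))%:A.
Proof.
have sqrD (u v : K) : (u + v) * (u + v) = u * u + v * v.
  rewrite mulrDl !mulrDr (mulrC v u) addrA -(addrA (u * u)).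
  by rewrite pchar2_addvv ?addr0.
have sqrZ a (u : K) : (a *: u) * (a *: u) = a ^+ 2 *: (u * u).
  by rewrite -scalerAl -scalerAr scalerA.
rewrite /biquad_comb !sqrD !sqrZ mulr1 mulrACA xx yy mulr_algl.
rewrite !scalerA !scalerDl.
rewrite -[_ * r * s]mulrA (mulrC (q.1.2 ^+ 2)) (mulrC (q.2.1 ^+ 2)).
by rewrite (mulrC (q.2.2 ^+ 2)).
Qed.

Lemma biquad_comb_inj : injective (biquad_comb x y).
Proof.
apply: raddf_inj => q q0; have := biquad_comb_sqr q.
rewrite q0 mulr0 => /esym/eqP; rewrite scaler_eq0 oner_eq0 orbF => /eqP.
by case: q q0 => [[a b] [c d]] /= _ /rs_indep [-> -> -> ->].
Qed.

Hypothesis gen : <<1 & [:: x; y]>>%VS = fullv :> {vspace K}.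

(** The combinations of [1, x, y, xy] form a subspace that contains 1 and is
    stable under multiplication by [x] and [y]. *)
Lemma biquad_comb_surj k : exists q, biquad_comb x y q = k.
Proof.
pose V := limg (linfun (biquad_comb x y)).
have inV q : biquad_comb x y q \in V.
  by rewrite -(lfunE (biquad_comb x y)) memv_img ?memvf.
have VP v : v \in V -> exists q, biquad_comb x y q = v.
  by case/memv_imgP => q _ ->; exists q; rewrite lfunE.
apply: (VP); suff -> : V = fullv by rewrite memvf.
apply/eqP; rewrite eqEsubv subvf -gen.
have x0 : x = biquad_comb x y ((0, 1), (0, 0)).
  by rewrite /biquad_comb /= !scale0r scale1r add0r !addr0.
have y0 : y = biquad_comb x y ((0, 0), (1, 0)).
  by rewrite /biquad_comb /= !scale0r scale1r !add0r !addr0.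
have xy : x * y = y * x by rewrite mulrC.
apply: agenv_sub_modl.
  rewrite -memvE.
  suff -> : 1 = biquad_comb x y ((1, 0), (0, 0)) by [].
  by rewrite /biquad_comb /= !scale0r scale1r !addr0.
apply/prodvP => u v uU /VP [q <-].
move: uU; rewrite !span_cons span_nil addv0.
rewrite -[1%VS]/(<[1]>%VS) => /memv_addP[_ /vlineP[a ->] [w wP ->]].
have [_ /vlineP[b ->] [_ /vlineP[c ->] ->]] := memv_addP wP.
have MV p : biquad_comb x y p * biquad_comb x y q \in V by rewrite biquad_combM.
rewrite !mulrDl -!scalerAl mul1r !memvD ?memvZ //.
  by have := MV ((0, 1), (0, 0)); rewrite -x0.
by have := MV ((0, 0), (1, 0)); rewrite -y0.
Qed.

End Generators.

Lemma biquad_square : is_sqrt_extension r s K ->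
  forall k : K, exists a : F, k * k = a%:A.
Proof.
move=> [x [y [xx yy gen]]] k; have [q <-] := biquad_comb_surj xx yy gen k.
by rewrite biquad_comb_sqr //; eexists.
Qed.

(** [K] is presented by [x^2 = r], [y^2 = s] and commutativity, since its
    dimension is 4: the lift is transported through coordinates. *)
Lemma biquad_lift (A : algType F) (X Y : A) :
    X * X = r%:A -> Y * Y = s%:A -> X * Y = Y * X ->
    is_sqrt_extension r s K ->
  exists (iota : {lrmorphism K -> A}),
    (exists x y, iota x = X /\ iota y = Y) /\
     forall k, exists q, iota k = biquad_comb X Y q.
Proof.
move=> XX YY XY [x [y [xx yy gen]]].
have xy : x * y = y * x by rewrite mulrC.
have kerlc : lker (linfun (biquad_comb x y)) = 0%VS.
  apply/eqP/lker0P => p q; rewrite !lfunE; exact: biquad_comb_inj.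
pose g : {linear K -> quad} := (linfun (biquad_comb x y))^-1%VF.
have gK k : biquad_comb x y (g k) = k.
  have [q <-] := biquad_comb_surj xx yy gen k.
  rewrite -(lfunE (biquad_comb x y) (g _)) limg_lfunVK //.
  by rewrite -(lfunE (biquad_comb x y)) memv_img ?memvf.
have Kg q : g (biquad_comb x y q) = q.
  by apply: (biquad_comb_inj xx yy); rewrite gK.
pose h k := biquad_comb X Y (g k).
have hlin : linear h by move=> a u v; rewrite /h !linearP.
have hmul : monoid_morphism h.
  split=> [|u v].
    have e1 (B : algType F) (Z T : B) : 1 = biquad_comb Z T ((1, 0), (0, 0)).
      by rewrite /biquad_comb /= !scale0r scale1r !addr0.
    by rewrite /h {1}(e1 _ x y) Kg -e1.
  by rewrite /h biquad_combM // -{1}[u]gK -{1}[v]gK biquad_combM // Kg.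
pose hL := GRing.isLinear.Build F K A _ h hlin.
pose hM := GRing.isMonoidMorphism.Build K A h hmul.
pose f : {lrmorphism K -> A} := HB.pack h hL hM.
exists f; split; last by move=> k; exists (g k).
exists x, y; rewrite /= /h; split.
  have -> : x = biquad_comb x y ((0, 1), (0, 0)).
    by rewrite /biquad_comb /= !scale0r scale1r add0r !addr0.
  by rewrite Kg /biquad_comb /= !scale0r scale1r add0r !addr0.
have -> : y = biquad_comb x y ((0, 0), (1, 0)).
  by rewrite /biquad_comb /= !scale0r scale1r !add0r !addr0.
by rewrite Kg /biquad_comb /= !scale0r scale1r !add0r !addr0.
Qed.

End Biquadratic.

(** * Split quaternion algebras *)

(** An induction principle over the subalgebra generated by [G]. *)
Definition generates (F : fieldType) (A : algType F) (G : A -> Prop) : Prop :=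
  forall S : A -> Prop, S 1 -> (forall a b, S a -> S b -> S (a + b)) ->
    (forall a b, S a -> S b -> S (a * b)) ->
    (forall (c : F) a, S a -> S (c *: a)) ->
    (forall a, G a -> S a) -> forall a, S a.

Section Quaternion.
Variables (F : fieldType) (r s q : F) (A : algType F) (X Y P Q : A).
Hypothesis F2 : 2%N \in [pchar F].
Hypothesis rs_indep : forall a b c d : F,
  (a ^+ 2 + r * b ^+ 2) + (s * c ^+ 2 + r * s * d ^+ 2) = 0 ->
  [/\ a = 0, b = 0, c = 0 & d = 0].
Hypotheses (r0 : r != 0) (s0 : s != 0).
Hypotheses (XX : X * X = r%:A) (YY : Y * Y = s%:A).
Hypotheses (PP : P * P = (r * s)%:A) (QQ : Q * Q = q%:A).
Hypothesis PQ : P * Q + Q * P = (r * s)%:A.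
Hypotheses (XC : forall a, X * a = a * X) (YC : forall a, Y * a = a * Y).
Hypothesis gen : generates (fun a => [\/ a = X, a = Y, a = P | a = Q]).
Variable K : fieldExtType F.
Hypothesis Krs : is_sqrt_extension r s K.

(** [N = P - X Y] squares to [rs + rs = 0], and [T = Q / (rs)] satisfies
    [N T + T N = 1].  The resulting morphism from the matrix algebra is onto
    because its image contains the four generators. *)
Lemma quaternion_iso : exists (iota : {lrmorphism K -> A})
    (g : {rmorphism 'M[K]_2 -> A}),
  [/\ is_central iota, bijective g, forall k, g k%:M = iota k
    & forall M, (forall a, g M * a = a * g M) -> g M = iota (M 0 0)].
Proof.
have [iota [[x [y [xX yY]]] iotaE]] := biquad_lift F2 rs_indep XX YY (XC Y) Krs.
have XYC a : X * Y * a = a * (X * Y) by rewrite -mulrA YC mulrA XC mulrA.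
have iotaC k a : iota k * a = a * iota k.
  have [p ->] := iotaE k; rewrite /biquad_comb !mulrDl !mulrDr.
  by rewrite -!scalerAl -!scalerAr mul1r mulr1 XYC (XC a) (YC a).
pose N := P - X * Y; pose T := (r * s)^-1 *: Q.
have rs0 : r * s != 0 by rewrite mulf_neq0.
have NN : N * N = 0.
  rewrite /N mulrBl !mulrBr XYC PP.
  have -> : X * Y * (X * Y) = (r * s)%:A.
    by rewrite mulrA -(mulrA X) YC mulrA XX mulr_algl -scalerAl YY scalerA.
  by rewrite opprB pchar2_addvv.
have NT : N * T + T * N = 1.
  rewrite /N /T -scalerAr -scalerAl -scalerDr mulrBl mulrBr XYC.
  by rewrite addrACA PQ -opprD pchar2_addvv // subr0 scalerA mulVf ?scale1r.
pose t := (r * s)^-1 ^+ 2 * q.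
have TT : T * T = t%:A by rewrite -scalerAl -scalerAr QQ !scalerA.
have TC : GRing.comm N (T ^+ 2).
  by rewrite /GRing.comm expr2 TT mulr_algl mulr_algr.
have gA := mx_to_alg_zmod iota N T.
have gM := mx_to_alg_monoid iotaC NN NT TC.
pose gAm := GRing.isZmodMorphism.Build 'M[K]_2 A _ gA.
pose gMm := GRing.isMonoidMorphism.Build 'M[K]_2 A _ gM.
pose g : {rmorphism 'M[K]_2 -> A} := HB.pack (mx_to_alg iota N T) gAm gMm.
have gk k : g k%:M = iota k by apply: mx_to_alg_scalar.
have gd i j : g (delta_mx i j) = mx_unit N T i j by apply: mx_to_alg_delta.
have ginj : injective g by apply: mx_to_alg_inj.
have gsurj a : exists M, g M = a.
  move: a; apply: gen.
  - by exists 1; rewrite rmorph1.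
  - by move=> _ _ [M <-] [M' <-]; exists (M + M'); rewrite rmorphD.
  - by move=> _ _ [M <-] [M' <-]; exists (M * M'); rewrite rmorphM.
  - move=> c _ [M <-]; exists (c%:A%:M * M); rewrite rmorphM gk.
    by rewrite linearZ rmorph1 mulr_algl.
  have gN : exists M, g M = N.
    by exists (delta_mx 0 1); rewrite gd /mx_unit !expr0 mul1r mulr1.
  have gT : exists M, g M = T.
    (* T = (N T + T N) T, where T N T is a matrix unit and T^2 = t *)
    exists (delta_mx 1 0 + (t%:A)%:M * delta_mx 0 1).
    rewrite rmorphD rmorphM gk linearZ rmorph1 !gd /mx_unit /=.
    rewrite !expr0 !expr1 mulr1 mul1r mulr_algl -[RHS]mul1r -NT mulrDl addrC.
    by rewrite -(mulrA N) TT mulr_algr.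
  move=> _ [] ->.
  - by exists x%:M; rewrite gk.
  - by exists y%:M; rewrite gk.
  - have [M gM'] := gN; exists (M + (x * y)%:M).
    have gxy : g (x * y)%:M = X * Y by rewrite gk rmorphM -xX -yY.
    by rewrite rmorphD gxy gM' subrK.
  - have [M gM'] := gT; exists (((r * s)%:A)%:M * M).
    rewrite rmorphM gk gM' linearZ rmorph1 mulr_algl /T scalerA mulfV //.
    by rewrite scale1r.
exists iota, g; split => //; last by apply: mx_to_alg_central.
have [h hE] := boolp.choice gsurj.
by exists h => [M|a] //; apply: ginj; rewrite hE.
Qed.

(** Two central embeddings of [K] agree: the squares of [iota' k] and [iota k]
    are the same scalar of [F], so their difference is central with square zero
    in characteristic 2, and central elements lie in a copy of the field [K]. *)
Lemma quaternion_split :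
  (exists iota : {lrmorphism K -> A}, is_central iota) /\
  (forall iota : {lrmorphism K -> A}, is_central iota -> is_split iota).
Proof.
have [iota [g [iotaC [f gK fK] gk gC]]] := quaternion_iso.
split; first by exists iota.
move=> iota' iota'C.
have eq_iota k : iota' k = iota k.
  have dC a : (iota' k - iota k) * a = a * (iota' k - iota k).
    by rewrite mulrBl mulrBr iotaC iota'C.
  have dd : (iota' k - iota k) * (iota' k - iota k) = 0.
    have [a kk] := biquad_square F2 Krs k.
    have sqr (h : {lrmorphism K -> A}) : h k * h k = a%:A.
      by rewrite -rmorphM kk; apply: rmorph_alg.
    by rewrite mulrBl !mulrBr !sqr iotaC opprB pchar2_addvv.
  have [m gd] : exists m, iota' k - iota k = iota m.
    by exists (f (iota' k - iota k) 0 0); rewrite -gC fK.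
  apply/eqP; rewrite -subr_eq0 gd; apply/eqP.
  move: dd; rewrite gd -rmorphM => /eqP; rewrite fmorph_eq0 mulf_eq0 orbb.
  by move/eqP ->; rewrite rmorph0.
have fA : zmod_morphism f.
  by move=> a b; apply: (can_inj gK); rewrite rmorphB !fK.
have fM : monoid_morphism f.
  by split=> [|a b]; apply: (can_inj gK); rewrite ?rmorph1 ?rmorphM !fK.
pose fAm := GRing.isZmodMorphism.Build A 'M[K]_2 _ fA.
pose fMm := GRing.isMonoidMorphism.Build A 'M[K]_2 _ fM.
exists 1%N, (HB.pack_for {rmorphism A -> 'M[K]_2} f fAm fMm).
split; first by exists g.
move=> k a /=; rewrite eq_iota -gk; apply: (can_inj gK).
rewrite fK -mul_scalar_mx.
by rewrite -[_ *m _]/(_ * _) rmorphM fK.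
Qed.

End Quaternion.

(** * Generators of the even Clifford algebra *)
Section EvenClifford.
Variables (F : fieldType) (phi : quadForm F).
Local Notation q := (qval phi).
Local Notation b := (polar (qval phi)).
Local Notation cv := (@clif_vec F phi).

Lemma clif_polar v w : cv v * cv w + cv w * cv v = (b v w)%:A.
Proof.
have := clif_vec_sqr (v + w); rewrite linearD mulrDl !mulrDr.
rewrite !clif_vec_sqr qvalD !scalerDl -!addrA => /addrI E.
by apply: (addIr (q w)%:A); rewrite -addrA E addrC.
Qed.

Hypothesis F2 : 2%N \in [pchar F].
Variable g0 : phi.
Hypotheses (qg0 : q g0 != 0) (rad0 : forall v, b g0 v = 0).

Lemma clif_radical_comm v : cv g0 * cv v = cv v * cv g0.
Proof.
have := clif_polar g0 v; rewrite rad0 scale0r => /eqP.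
rewrite addr_eq0 => /eqP ->; apply/eqP.
by rewrite eq_sym -addr_eq0 pchar2_addvv.
Qed.

Lemma even_gen_subproof v : (q g0)^-1 *: (cv g0 * cv v) \in @even_pred F phi.
Proof.
apply/asboolP/even_scale; have := @even_prod F phi [:: g0; v] isT.
by rewrite !big_cons big_nil mulr1.
Qed.

(** [g0] is central with square [q g0], so this map behaves like the Clifford
    map of [q / q g0], but with values in the even part and [g0] sent to 1. *)
Definition even_gen v : even_clifford phi := EvenClifford (even_gen_subproof v).

Lemma even_gen_linear : linear even_gen.
Proof.
move=> a v w; apply: val_inj; rewrite linearP /=.
by rewrite linearP mulrDr scalerDr -scalerAr scalerA mulrC -scalerA.
Qed.

HB.instance Definition _ := GRing.isLinear.Build F phi (even_clifford phi) _
  even_gen even_gen_linear.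

Lemma even_val_alg c : \val (c%:A : even_clifford phi) = c%:A.
Proof. by []. Qed.

Lemma even_genM v w :
  even_val (even_gen v * even_gen w) = (q g0)^-1 *: (cv v * cv w).
Proof.
rewrite -[LHS]/(\val _) rmorphM /= -scalerAl -scalerAr scalerA.
rewrite -mulrA (mulrA (cv v)) -clif_radical_comm.
rewrite -(mulrA (cv g0)) (mulrA (cv g0) (cv g0)) clif_vec_sqr.
by rewrite mulr_algl scalerA -mulrA mulVf // mulr1.
Qed.

Lemma even_gen1 : even_gen g0 = 1.
Proof.
by apply: val_inj; rewrite rmorph1 /= clif_vec_sqr scalerA mulVf // scale1r.
Qed.

Lemma even_gen_sqr v : even_gen v * even_gen v = (q v / q g0)%:A.
Proof.
apply: val_inj; rewrite [LHS]even_genM clif_vec_sqr even_val_alg scalerA.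
by rewrite mulrC.
Qed.

Lemma even_gen_polar v w :
  even_gen v * even_gen w + even_gen w * even_gen v = (b v w / q g0)%:A.
Proof.
apply: val_inj; rewrite even_val_alg; apply: etrans (rmorphD _ _ _) _.
rewrite [LHS](congr2 +%R (even_genM v w) (even_genM w v)).
by rewrite -scalerDr clif_polar scalerA mulrC.
Qed.

(** A product [v w] of two vectors is [q g0] times the product of the generators
    attached to [v] and [w]. *)
Lemma even_gen_generates : generates (fun a => exists v, a = even_gen v).
Proof.
move=> S S1 SD SM SZ Sg.
suff sS c : in_even c -> exists2 a, S a & \val a = c.
  move=> a; have /asboolP /sS [a' Sa' a'E] := even_valP a.
  by have <- : a' = a by apply: val_inj.
elim=> {c} [t|x y _ [a Sa <-] _ [a' Sa' <-]|d x _ [a Sa <-]]; last 2 first.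
- by exists (a + a'); [apply: SD | rewrite rmorphD].
- by exists (d *: a); [apply: SZ | rewrite linearZ].
have [n] := ubnP (size t); elim: n t => // n IHn [|v [|w t]] //= tn todd.
  by exists 1; rewrite // big_nil.
have [a Sa aE] : exists2 a, S a & \val a = \prod_(v <- t) cv v.
  by apply: IHn; [exact: ltnW | rewrite negbK in todd].
exists (q g0 *: (even_gen v * even_gen w * a)).
  by apply: (SZ); apply: (SM) => //; apply: (SM); apply: (Sg); eexists.
transitivity (q g0 *: (\val (even_gen v * even_gen w) * \val a)) => //.
rewrite [X in _ *: (X * _)]even_genM aE.
rewrite !big_cons mulrA -scalerAl scalerA.
by rewrite mulfV // scale1r.
Qed.

Lemma even_gen_central w : (forall v, b w v = 0) ->
  forall a, even_gen w * a = a * even_gen w.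
Proof.
move=> wrad; apply: even_gen_generates.
- by rewrite mulr1 mul1r.
- by move=> a a' aE a'E; rewrite mulrDr mulrDl aE a'E.
- by move=> a a' aE a'E; rewrite mulrA aE -mulrA a'E mulrA.
- by move=> c a aE; rewrite -scalerAr -scalerAl aE.
move=> _ [v ->]; have := even_gen_polar w v; rewrite wrad mul0r scale0r.
move=> /eqP; rewrite addr_eq0 => /eqP ->; apply/eqP.
by rewrite eq_sym -addr_eq0 pchar2_addvv.
Qed.

End EvenClifford.

Lemma even_clifford_split (F : fieldType) (phi : quadForm F) (r s u alpha : F)
    (K : fieldExtType F) :
  2%N \in [pchar F] -> anisotropic phi ->
  r != 0 -> s != 0 -> alpha != 0 ->
  isometric phi
    (qscale alpha (qperp (qscale (r * s) (qbin 1 u)) (qdiag [:: 1; r; s]))) ->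
  is_sqrt_extension r s K ->
  (exists iota : {lrmorphism K -> even_clifford phi}, is_central iota) /\
  (forall iota : {lrmorphism K -> even_clifford phi},
     is_central iota -> is_split iota).
Proof.
move=> F2 aniso r0 s0 alpha0 /isometric_sym [f [[g fK gK] fq]] Krs.
have fp x y : polar (qval phi) (f x) (f y) = polar (qval _) x y.
  by rewrite /polar -linearD -!fq.
pose h (a b c0 c1 c2 : F) : phi :=
  f ((a, b), \row_i [:: c0; c1; c2]`_i).
pose f1 := h 1 0 0 0 0; pose f2 := h 0 1 0 0 0.
pose g0 := h 0 0 1 0 0; pose g1 := h 0 0 0 1 0; pose g2 := h 0 0 0 0 1.
have hD a b c0 c1 c2 : h a b c0 c1 c2 =
    a *: f1 + b *: f2 + (c0 *: g0 + c1 *: g1 + c2 *: g2).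
  rewrite -!linearZ -!linearD; congr (f _).
  have sE (c d : F) : c *: (d : F^o) = c * d by [].
  congr pair; first by congr pair; rewrite /= !sE ?mulr1 ?mulr0 ?addr0 ?add0r.
  apply/rowP => i; rewrite !mxE.
  by case: i => [[|[|[|]]] //= _]; ring.
have span v : exists a b c0 c1 c2, v = h a b c0 c1 c2.
  rewrite -[v]gK; case: (g v) => [[a b] c].
  exists a, b, (c 0 0), (c 0 1), (c 0 (1 + 1)); congr (f (_, _)).
  apply/rowP => i; rewrite mxE.
  by case: i => [[|[|[|]]] //= p]; congr (c _ _); apply: val_inj.
have hq a b c0 c1 c2 : qval phi (h a b c0 c1 c2) =
    alpha * (r * s * (a ^+ 2 + a * b + u * b ^+ 2)
             + (c0 ^+ 2 + r * c1 ^+ 2 + s * c2 ^+ 2)).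
  by rewrite /h -fq /= !big_ord_recl big_ord0 !mxE /=; ring.
have hp a b c0 c1 c2 a' b' c0' c1' c2' :
  polar (qval phi) (h a b c0 c1 c2) (h a' b' c0' c1' c2') =
    alpha * (r * s * (a * b' + a' * b)).
  pose z := alpha * (r * s * (a * a' + u * (b * b'))
                     + (c0 * c0' + r * (c1 * c1') + s * (c2 * c2'))).
  rewrite -[RHS]addr0 -[X in _ + X](mul0r z) -(pchar2D F2) fp /polar /=.
  by rewrite !big_ord_recl !big_ord0 !mxE /= /z; ring.
have qg0 : qval phi g0 = alpha by rewrite hq; ring.
have qg00 : qval phi g0 != 0 by rewrite qg0.
have rad0 v : polar (qval phi) g0 v = 0.
  by have [a [b [c0 [c1 [c2 ->]]]]] := span v; rewrite hp; ring.
pose m := even_gen g0.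
have mC c d : forall a, m (h 0 0 0 c d) * a = a * m (h 0 0 0 c d).
  apply: even_gen_central => // v.
  by have [a [b [c0 [c1 [c2 ->]]]]] := span v; rewrite hp; ring.
apply: (@quaternion_split _ r s (r * s * u) _ (m g1) (m g2) (m f1) (m f2))
  => //.
- move=> a b c d E.
  have E0 : qval phi (h d 0 a b c) = 0.
    rewrite hq; apply: etrans (mulr0 alpha).
    by rewrite -[X in _ = _ * X]E; ring.
  have /(can_inj fK) [-> /rowP v0] := etrans (aniso _ E0) (esym (linear0 f)).
  by split=> //; [have := v0 0 | have := v0 1 | have := v0 (1 + 1)];
    rewrite !mxE.
- by rewrite even_gen_sqr // hq qg0; congr (_ *: _); field.
- by rewrite even_gen_sqr // hq qg0; congr (_ *: _); field.
- by rewrite even_gen_sqr // hq qg0; congr (_ *: _); field.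
- by rewrite even_gen_sqr // hq qg0; congr (_ *: _); field.
- by rewrite even_gen_polar // hp qg0; congr (_ *: _); field.
- exact: mC.
- exact: mC.
move=> S S1 SD SM SZ Sg; apply: (even_gen_generates F2 qg00 rad0) => //.
move=> _ [v ->]; have [a [b [c0 [c1 [c2 ->]]]]] := span v.
rewrite hD !linearD !linearZ /= even_gen1 //.
by do !apply: (SD); apply: (SZ) => //; apply: (Sg); constructor.
Qed.

Theorem corollary1 (F : fieldType) (charF2 : 2%N \in [pchar F])
    (phi : quadForm F) :
  anisotropic phi -> of_type 1 3 phi -> pfister_neighbor phi ->
  exists r s u : F,
    [/\ r != 0, s != 0, u != 0,
        exists2 alpha : F, alpha != 0 &
          isometric phi
            (qscale alpha (qperp (qscale (r * s) (qbin 1 u))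
                                 (qdiag [:: 1; r; s])))
      & forall K : fieldExtType F, is_sqrt_extension r s K ->
          (exists iota : {lrmorphism K -> even_clifford phi},
             is_central iota) /\
          (forall iota : {lrmorphism K -> even_clifford phi},
             is_central iota -> is_split iota)].
Proof.
move=> aniso t13 pn.
have [r [s [u [alpha [r0 s0 u0 alpha0 iso]]]]] :=
  neighbor_normal_form charF2 aniso t13 pn.
exists r, s, u; split=> //; first by exists alpha.
move=> K; exact: even_clifford_split iso.
Qed.
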